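(* Let $\lambda\in\mathbb{N}_0^N$ be a partition ($\lambda_1\ge\dots\ge\lambda_N$) and $T\in\mathcal{Y}(\tau)$ with $\lfloor\lambda,T\rfloor$ column-strict; let $T_R,T_S$ be the tableaux defined below from $\mathcal{T}:=\lfloor\lambda,T\rfloor$, and let $\lambda^-$ be the nondecreasing rearrangement of $\lambda$. Then $$\|J_{\lambda,T_S}\|^2=\#\mathcal{T}(\lambda,T_S)\cdot\frac{\mathcal{C}_1(T_R)}{\mathcal{C}_1(T_S)\,\mathcal{E}_1(\lambda^-,T_R)}\,\|\zeta_{\lambda,T_S}\|^2.$$
   Context: Notation. $\mathcal{S}_N$ acts on $x\in\mathbb{C}^N$ by $(xw)_i=x_{w(i)}$ and on $\alpha\in\mathbb{Z}^N$ by $(w\alpha)_i=\alpha_{w^{-1}(i)}$. $\tau$ is a partition of $N$ other than $(N),(1^N)$; $\mathcal{Y}(\tau)$ is the set of reverse standard Young tableaux (fillings of the Ferrers diagram with $1,\dots,N$ decreasing along rows and columns); $c(i,T)=\mathrm{cm}(i,T)-\mathrm{rw}(i,T)$. $V_\tau$ has basis $\mathcal{Y}(\tau)$ with the irreducible orthogonal (Young) representation $\tau$ and invariant inner product $\langle T,T'\rangle_0=\delta_{T,T'}\prod_{i<j,\ c(i,T)\le c(j,T)-2}(1-(c(i,T)-c(j,T))^{-2})$; $\mathcal{P}_\tau$ = $V_\tau$-valued polynomials with $(wp)(x)=\tau(w)p(xw)$. $\mathcal{D}_ip=\partial_ip+\kappa\sum_{j\ne i}\tau(i,j)\frac{p(x)-p(x(i,j))}{x_i-x_j}$,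 $\mathcal{U}_ip=\mathcal{D}_i(x_ip)-\kappa\sum_{j<i}\tau(i,j)p(x(i,j))$, with $-1/h_\tau<\kappa<1/h_\tau$, $h_\tau=\tau_1+\ell(\tau)-1$. $\langle\cdot,\cdot\rangle_{\mathbb{T}}$ is the unique Hermitian form on $\mathcal{P}_\tau$ (conjugate-linear in the first, linear in the second argument) with $\langle1\otimes T,1\otimes T'\rangle_{\mathbb{T}}=\langle T,T'\rangle_0$, $\langle wf,wg\rangle_{\mathbb{T}}=\langle f,g\rangle_{\mathbb{T}}$, $\langle x_i\mathcal{D}_if,g\rangle_{\mathbb{T}}=\langle f,x_i\mathcal{D}_ig\rangle_{\mathbb{T}}$, $\langle x_if,x_ig\rangle_{\mathbb{T}}=\langle f,g\rangle_{\mathbb{T}}$; $\|p\|^2=\langle p,p\rangle_{\mathbb{T}}$. For $\alpha\in\mathbb{N}_0^N$: $\alpha^+$ its nonincreasing rearrangement; $r_\alpha(i)=\#\{j:\alpha_j>\alpha_i\}+\#\{j\le i:\alpha_j=\alpha_i\}$. $\beta\vartriangleleft\alpha$ iff $|\beta|=|\alpha|$ and either $\beta^+\prec\alpha^+$ or ($\beta^+=\alpha^+$ and $\beta\prec\alpha$), where $\beta\prec\alpha$ means $\beta\neq\alpha$ and all partial sums of $\beta$ are $\le$ those of $\alpha$. $\zeta_{\alpha,T}$ is the unique element of $\mathcal{P}_\tau$ of the form $x^\alpha\otimes\tau(r_\alpha^{-1})T+\sum_{\beta\vartriangleleft\alpha}x^\beta\otimes t_{\alpha\beta}$ with $\mathcal{U}_i\zeta_{\alpha,T}=(\alpha_i+1+\kappa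 c(r_\alpha(i),T))\zeta_{\alpha,T}$ for all $i$. $\lfloor\alpha,T\rfloor$: replace each entry $i$ of $T$ by $\alpha^+_i$; column-strict means strictly increasing down columns and weakly increasing along rows. $\mathcal{T}(\alpha,T)=\{(\beta,T'):\lfloor\beta,T'\rfloor=\lfloor\alpha,T\rfloor\}$. With $\mathcal{T}=\lfloor\lambda,T\rfloor$ and cells $(i,j)$ (row, column): $T_R(i,j)=\#\{(k,l):\mathcal{T}(k,l)>\mathcal{T}(i,j)\}+\#\{(k,l):\mathcal{T}(k,l)=\mathcal{T}(i,j),\ l>j\text{ or }(l=j,k\ge i)\}$; $T_S(i,j)=\#\{(k,l):\mathcal{T}(k,l)>\mathcal{T}(i,j)\}+\#\{(k,l):\mathcal{T}(k,l)=\mathcal{T}(i,j),\ k>i\text{ or }(k=i,l\ge j)\}$. $\mathcal{E}_\varepsilon(\alpha,T)=\prod_{i<j,\ \alpha_i<\alpha_j}\bigl(1+\frac{\varepsilon\kappa}{\alpha_j-\alpha_i+\kappa(c(r_\alpha(j),T)-c(r_\alpha(i),T))}\bigr)$, $\mathcal{C}_\varepsilon(T)=\prod_{i<j,\ c(i,T)\le c(j,T)-2}\bigl(1+\frac{\varepsilon}{c(i,T)-c(j,T)}\bigr)$, $\varepsilon=\pm1$. $J_{\lambda,T_S}:=\sum_{(\beta,T')\in\mathcal{T}(\lambda,T_S)}\frac{\mathcal{C}_{-1}(T_S)}{\mathcal{C}_{-1}(T')}\mathcal{E}_{-1}(\beta,T')\zeta_{\beta,T'}$. *)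

(* Defs.v *)
From HB Require Import structures.
From mathcomp Require Import all_boot all_order fingroup perm all_algebra.
Set Implicit Arguments. Unset Strict Implicit. Unset Printing Implicit Defensive.
Import Order.TTheory GRing.Theory Num.Theory.
Local Open Scope ring_scope.

Section Tableaux.
Variables (N : nat) (sh : seq nat).

Definition is_partition : bool :=
  sorted geq sh && (0%N \notin sh) && (sumn sh == N).

Definition hook : nat := (head 0%N sh + size sh).-1.

(* cells are (row, column), 0-based *)
Definition in_diag (c : 'I_N * 'I_N) : bool := (c.2 < nth 0%N sh c.1)%N.

(* A raw tableau: entry k+1 (k : 'I_N, 0-based) sits in cell T k. *)
Definition rawtab := {ffun 'I_N -> 'I_N * 'I_N}.

Definition is_rsyt (T : rawtab) : bool :=
  [&& injectiveb T, [forall k, in_diag (T k)],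
      [forall k, [forall l,
         ((T k).1 == (T l).1) && ((T k).2 < (T l).2)%N ==> (l < k)%N]]
    & [forall k, [forall l,
         ((T k).2 == (T l).2) && ((T k).1 < (T l).1)%N ==> (l < k)%N]]].

Definition tab := {T : rawtab | is_rsyt T}.

Definition contz (T : tab) (k : 'I_N) : int :=
  (val T k).2%:Z - (val T k).1%:Z.

Definition contn (T : tab) (k : nat) : int :=
  if insub k is Some k' then contz T k' else 0.

End Tableaux.

Section Mono.
Variable N : nat.
Definition mono := {ffun 'I_N -> nat}.
Definition mono0 : mono := [ffun _ => 0%N].
Definition seqm (a : mono) : seq nat := [seq a i | i <- enum 'I_N].
Definition degm (a : mono) : nat := (\sum_(i < N) a i)%N.
Definition plusm (a : mono) : seq nat := sort geq (seqm a).
Definition minusm (a : mono) : mono := [ffun i : 'I_N => nth 0%N (sort leq (seqm a)) i].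
Definition psum (s : seq nat) (j : nat) : nat := (\sum_(i < j) nth 0%N s i)%N.
Definition domlt (s t : seq nat) : bool :=
  (s != t) && all (fun j => psum s j <= psum t j)%N (iota 0 N.+1).
Definition tri (b a : mono) : bool :=
  (degm b == degm a) &&
  (domlt (plusm b) (plusm a) || ((plusm b == plusm a) && domlt (seqm b) (seqm a))).
(* r_alpha(i), 1-based *)
Definition rank (a : mono) (i : 'I_N) : nat :=
  (#|[pred j : 'I_N | a i < a j]| + #|[pred j : 'I_N | (j <= i)%N && (a j == a i)]|)%N.
End Mono.

Section Poly.
Variable C : numClosedFieldType.
Variables (N : nat) (sh : seq nat).
Local Notation tab := (tab N sh).
Local Notation mono := (mono N).

Definition vec := tab -> C.               (* V_tau, coordinates in tbasis Y(tau) *)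
Definition vzero : vec := fun _ => 0.
Definition tbasis (T : tab) : vec := fun T' => (T' == T)%:R.
Definition vmat := tab -> tab -> C.        (* M T' T = coefficient of T' in M(T) *)
Definition mapp (M : vmat) (v : vec) : vec := fun T' => \sum_T M T' T * v T.
Definition mmul (A B : vmat) : vmat := fun T' T => \sum_U A T' U * B U T.
Definition idm : vmat := fun T' T => (T' == T)%:R.

Definition cont (T : tab) (k : 'I_N) : C := (contz T k)%:~R.

(* action of the adjacent transposition (i,j), j = i+1, on tbasis:
   tau(s) T = (1/b) T + coef * T^(i),  b = c(i,T) - c(i+1,T),
   coef = 1 if b >= 2, 1 - 1/b^2 if b <= -2; T^(i) = T with i,i+1 swapped. *)
Definition Ms (i j : 'I_N) : vmat := fun T' T =>
  let bz := (contz T i - contz T j)%R in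
  let b : C := bz%:~R in
  (if T' == T then b^-1 else 0) +
  (if val T' == [ffun l => val T (tperm i j l)] then
     (if (2 <= bz)%R then 1 else if (bz <= -2)%R then 1 - b^-2 else 0)
   else 0).

(* tau : S_N -> End(V_tau) the representation determined by Young's form.
   Composition convention: paper's w1 w2 = w1 o w2 = (w2 * w1)%g in mathcomp. *)
Definition is_young_rep (rho : {perm 'I_N} -> vmat) : Prop :=
  [/\ rho 1%g = idm,
      (forall s t : {perm 'I_N}, rho (s * t)%g = mmul (rho t) (rho s))
    & (forall i j : 'I_N, val j = (val i).+1 -> rho (tperm i j) = Ms i j)].

Definition ip0 (T T' : tab) : C :=
  if T == T' then
    \prod_(i < N) \prod_(j < N | (i < j)%N && (contz T i <= contz T j - 2)%R)
       (1 - (((contz T i - contz T j)%R)%:~R)^-2)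
  else 0.

(* V_tau-valued polynomials, by coefficient functions *)
Definition vpoly := mono -> vec.
Definition finsupp (p : vpoly) : Prop :=
  exists s : seq mono, forall b, b \notin s -> p b = vzero.
Definition pone (T : tab) : vpoly := fun b => if b == mono0 N then tbasis T else vzero.
Definition padd (p q : vpoly) : vpoly := fun b T => p b T + q b T.
Definition pscale (a : C) (p : vpoly) : vpoly := fun b T => a * p b T.

(* p(xw): coefficient at beta is p at (i |-> beta_{w(i)}) *)
Definition pvar (w : {perm 'I_N}) (p : vpoly) : vpoly := fun b => p [ffun i => b (w i)].
Definition pact (rho : {perm 'I_N} -> vmat) (w : {perm 'I_N}) (p : vpoly) : vpoly :=
  fun b => mapp (rho w) (pvar w p b).
Definition mulx (i : 'I_N) (p : vpoly) : vpoly := fun b =>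
  if (0 < b i)%N then p [ffun l => if l == i then (b l).-1 else b l] else vzero.
Definition dpart (i : 'I_N) (p : vpoly) : vpoly := fun b T =>
  ((b i).+1)%:R * p [ffun l => if l == i then (b l).+1 else b l] T.
Definition upd2 (b : mono) (i : 'I_N) (x : nat) (j : 'I_N) (y : nat) : mono :=
  [ffun l => if l == i then x else if l == j then y else b l].
(* coefficient of x_i^k x_j^(a+b-1-k) in (x_i^a x_j^b - x_i^b x_j^a)/(x_i - x_j) *)
Definition ddc (a c k : nat) : C :=
  if (c < a)%N then (if (c <= k < a)%N then 1 else 0)
  else if (a < c)%N then (if (a <= k < c)%N then -1 else 0) else 0.
(* divided difference (p(x) - p(x(i,j)))/(x_i - x_j), i <> j *)
Definition dd (i j : 'I_N) (p : vpoly) : vpoly := fun b T =>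
  let s := (b i + b j)%N in
  \sum_(a < s.+2) ddc a (s.+1 - a) (b i) * p (upd2 b i a j (s.+1 - a)) T.

Definition Dunkl (k : C) (rho : {perm 'I_N} -> vmat) (i : 'I_N) (p : vpoly) : vpoly :=
  fun b T => dpart i p b T +
    k * \sum_(j < N | j != i) mapp (rho (tperm i j)) (dd i j p b) T.
Definition Uop (k : C) (rho : {perm 'I_N} -> vmat) (i : 'I_N) (p : vpoly) : vpoly :=
  fun b T => Dunkl k rho i (mulx i p) b T -
    k * \sum_(j < N | (j < i)%N) mapp (rho (tperm i j)) (pvar (tperm i j) p b) T.

Definition is_form (k : C) (rho : {perm 'I_N} -> vmat) (H : vpoly -> vpoly -> C) : Prop :=
  [/\ (forall f g h a, finsupp f -> finsupp g -> finsupp h ->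
         H f (padd (pscale a g) h) = a * H f g + H f h),
      (forall f g, finsupp f -> finsupp g -> H g f = Num.conj (H f g)),
      (forall T T', H (pone T) (pone T') = ip0 T T')
    & ((forall w f g, finsupp f -> finsupp g -> H (pact rho w f) (pact rho w g) = H f g)
      /\
      (forall i f g, finsupp f -> finsupp g ->
         H (mulx i (Dunkl k rho i f)) g = H f (mulx i (Dunkl k rho i g)))
      /\ (forall i f g, finsupp f -> finsupp g -> H (mulx i f) (mulx i g) = H f g))].

Definition is_zeta (k : C) (rho : {perm 'I_N} -> vmat) (a : mono) (T : tab) (p : vpoly) : Prop :=
  [/\ (forall w : {perm 'I_N}, (forall i, val (w i) = (rank a i).-1) ->
         p a = mapp (rho w^-1%g) (tbasis T)),
      (forall b, b != a -> ~~ tri b a -> p b = vzero)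
    & (forall i, Uop k rho i p =
         pscale ((a i)%:R + 1 + k * (contn T (rank a i).-1)%:~R) p)].

Definition fill (a : mono) (T : tab) (c : 'I_N * 'I_N) : nat :=
  if [pick k | val T k == c] is Some k then nth 0%N (plusm a) k else 0%N.

Definition colstrict (F : 'I_N * 'I_N -> nat) : Prop :=
  (forall r r' c : 'I_N, val r' = (val r).+1 -> in_diag sh (r', c) -> (F (r, c) < F (r', c))%N)
  /\ (forall r c c' : 'I_N, val c' = (val c).+1 -> in_diag sh (r, c') -> (F (r, c) <= F (r, c'))%N).

Definition TRnum (F : 'I_N * 'I_N -> nat) (c : 'I_N * 'I_N) : nat :=
  (#|[pred d | in_diag sh d && (F c < F d)%N]| +
   #|[pred d | [&& in_diag sh d, F d == F c &
                ((c.2 < d.2)%N || ((d.2 == c.2) && (c.1 <= d.1)%N))]]|)%N.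
Definition TSnum (F : 'I_N * 'I_N -> nat) (c : 'I_N * 'I_N) : nat :=
  (#|[pred d | in_diag sh d && (F c < F d)%N]| +
   #|[pred d | [&& in_diag sh d, F d == F c &
                ((c.1 < d.1)%N || ((d.1 == c.1) && (c.2 <= d.2)%N))]]|)%N.
Definition is_numbered (num : 'I_N * 'I_N -> nat) (T' : tab) : Prop :=
  forall c, in_diag sh c -> exists k : 'I_N, val k = (num c).-1 /\ val T' k = c.

(* T(alpha,T): all (beta,T') with the same filling; such beta are permutations of alpha *)
Definition Tset (a : mono) (T : tab) : seq (mono * tab) :=
  [seq bt <- [seq (b, T') | b <- undup [seq ([ffun i => a (w i)] : mono) | w : {perm 'I_N} <- enum {: {perm 'I_N}}],
                          T' <- enum {: tab}]
   | [forall c, fill bt.1 bt.2 c == fill a T c]].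

Definition Ceps (e : C) (T : tab) : C :=
  \prod_(i < N) \prod_(j < N | (i < j)%N && (contz T i <= contz T j - 2)%R)
     (1 + e / ((contz T i - contz T j)%R)%:~R).

Definition Eeps (k e : C) (a : mono) (T : tab) : C :=
  \prod_(i < N) \prod_(j < N | (i < j)%N && (a i < a j)%N)
     (1 + e * k / ((a j)%:R - (a i)%:R +
                   k * ((contn T (rank a j).-1 - contn T (rank a i).-1)%R)%:~R)).

Definition Jpoly (k : C) (zeta : mono -> tab -> vpoly) (lam : mono) (TS : tab) : vpoly :=
  fun b T => \sum_(bt <- Tset lam TS)
    Ceps (-1) TS / Ceps (-1) bt.2 * Eeps k (-1) bt.1 bt.2 * zeta bt.1 bt.2 b T.

End Poly.

(* Main.v *)
(* Number the cells through T_S.  A member (beta, T') of the set T(lambda, T_S)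
   is then a permutation s, s(i) being the cell T' assigns to r_beta(i), and
   the permutations that occur are those listing each row segment of equal
   entries from right to left.  Put b(p,q) = kappa / (xi_p - xi_q) with
   xi_p = lambda_p + kappa c(p).  Passing from s to s s_i at a descent multiplies
   the squared norm of zeta by 1 - b^2, and the coefficient of zeta in J is the
   product of 1 - b(p,q) over the inversions p < q of s.  Since the zeta are
   orthogonal,
     |J|^2 prod_{p<q} (1 + b(p,q)) = |zeta|^2 sum_s prod_{i<j} (1 + b(s(i),s(j))).
   The sum may be taken over all of S_N, because 1 + b vanishes on horizontally
   adjacent cells of a segment listed in the wrong order, and it equals N! by a
   rational function identity that only uses that b is antisymmetric and
   satisfies b(p,q) b(p,r) = b(q,r) (b(p,q) - b(p,r)).  The restriction of b to
   pairs of cells in one segment satisfies the same relations, so the same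
   identity yields the cardinality of T(lambda, T_S). *)

(* The tableau T_R enters through the longest admissible word: in the word of (lambda^-, T_R) two
   cells p < q are inverted exactly when they lie in different row segments. Hence C_1(T_S)
   E_1(lambda^-, T_R) / C_1(T_R) is the product of 1 + b over all pairs divided by the product over
   the pairs inside one segment, and this quotient links the two evaluations of the permutation sum.
   The relation zeta_{s_i alpha} = s_i zeta_alpha - b zeta_alpha behind the norm ratios is not
   obtained by expanding polynomials. Both sides are joint eigenvectors of the U_i with the same
   leading coefficient, and the bound on kappa makes such an eigenvector unique: contents differ by
   less than h_tau, so kappa times a difference of contents is never a nonzero integer. The value
   kappa = 0 is allowed and is the main obstacle. There the xi_p no longer separate cells with equal
   entries, so kappa is cancelled from b on such pairs, and orthogonality has to be drawn from V_tau
   itself. *)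
Require Import Defs.
From HB Require Import structures.
From mathcomp Require Import all_boot all_order fingroup perm all_algebra.
From Stdlib Require Import FunctionalExtensionality.
From mathcomp Require Import zify ring.
Import Order.TTheory GRing.Theory Num.Theory.
Import Defs.
Set Implicit Arguments. Unset Strict Implicit. Unset Printing Implicit Defensive.
Local Open Scope ring_scope.

(** * The rational function identity summed over all permutations *)

Section PermutationIdentity.
Variable R : comNzRingType.

(* Writing G A for the sum, any distinct q, r in A satisfy
   G A = (1 + b q r) G (A \ r) + (1 - b q r) G (A \ q) - G (A \ {q, r}). *)
Lemma sum_prod_pairs (I : finType) (b : I -> I -> R) (A : {set I}) :
  (forall p q, b q p = - b p q) ->
  (forall p q r, p != q -> p != r -> q != r ->
     b p q * b p r = b q r * (b p q - b p r)) ->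
  \sum_(p in A) \prod_(q in A | q != p) (1 + b p q) = #|A|%:R.
Proof.
move=> bN b3; set F := fun (B : {set I}) p => \prod_(q in B | q != p) (1 + b p q).
have FD (B : {set I}) p x : x \in B -> x != p -> F B p = (1 + b p x) * F (B :\ x) p.
  move=> xB xp; rewrite /F (bigD1 x) ?xB //=; congr (_ * _).
  by apply: eq_bigl => q; rewrite !inE; case: (q == x); rewrite ?andbF ?andbT.
change (\sum_(p in A) F A p = #|A|%:R).
have [n] := ubnP #|A|; elim: n A => // n IH A /ltnSE leAn.
have [|A1] := leqP #|A| 1.
  rewrite leq_eqVlt ltnS leqn0 => /orP[/cards1P[x ->]|]; last first.
    by rewrite cards_eq0 => /eqP->; rewrite big_set0 cards0.
  rewrite big_set1 cards1 /F big1 // => q; rewrite inE => /andP[/eqP->].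
  by rewrite eqxx.
have [q [r [qA rA qr]]] := card_gt1P A1.
have rAq : r \in A :\ q by rewrite !inE eq_sym qr.
have qAr : q \in A :\ r by rewrite !inE qr.
have rq : r != q by rewrite eq_sym.
have sD (B : {set I}) x f : x \in B ->
    \sum_(p in B) f p = f x + \sum_(p in B :\ x) f p :> R.
  move=> xB; rewrite (bigD1 x) //=; congr (_ + _).
  by apply: eq_bigl => p; rewrite !inE andbC.
have card1 : #|A| = #|A :\ q|.+1 by rewrite (cardsD1 q A) qA.
have card2 : #|A| = #|A :\ r|.+1 by rewrite (cardsD1 r A) rA.
have card3 : #|A :\ q| = #|A :\ q :\ r|.+1 by rewrite (cardsD1 r (A :\ q)) rAq.
have E1 := IH (A :\ q) _; have E2 := IH (A :\ r) _; have E3 := IH (A :\ q :\ r) _.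
have {}E1 := E1 ltac:(lia); have {}E2 := E2 ltac:(lia); have {}E3 := E3 ltac:(lia).
have Dqr : A :\ r :\ q = A :\ q :\ r by rewrite !setDDl setUC.
move: E1 E2; rewrite (sD (A :\ q) r) // (sD (A :\ r) q) // Dqr.
rewrite (sD A q) // (sD (A :\ q) r) // => E1 E2.
have FA p : p \in A :\ q :\ r ->
   F A p = (1 + b q r) * F (A :\ r) p + (1 - b q r) * F (A :\ q) p - F (A :\ q :\ r) p.
  rewrite !inE => /and3P[pr pq pA]; have H3 := b3 _ _ _ pq pr qr.
  rewrite (FD A p q) ?(FD (A :\ q) p r) // 1?eq_sym // (FD (A :\ r) p q) 1?eq_sym // Dqr.
  set X := F (A :\ q :\ r) p; ring: H3.
rewrite (eq_bigr _ FA) sumrB big_split /= -!mulr_sumr E3.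
rewrite (FD A q r) // (FD A r q) // bN.
have -> : F (A :\ r) q = #|A :\ r|%:R - \sum_(i in A :\ q :\ r) F (A :\ r) i.
  by rewrite -E2 addrK.
have -> : F (A :\ q) r = #|A :\ q|%:R - \sum_(i in A :\ q :\ r) F (A :\ q) i.
  by rewrite -E1 addrK.
have -> : #|A :\ r| = #|A :\ q :\ r|.+1 by lia.
rewrite card1 card3 -!natr1; ring.
Qed.

(** Group the permutations by j = s(0). The pairs starting at position 0 contribute the product of 1
    + b(j,q) over q != j, whatever the rest of s, and the other positions give the same sum over the
    n remaining indices. The first factors add up to n + 1 by [sum_prod_pairs]. *)
Lemma sum_perm_pairs n (b : 'I_n -> 'I_n -> R) :
  (forall p q, b q p = - b p q) ->
  (forall p q r, p != q -> p != r -> q != r ->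
     b p q * b p r = b q r * (b p q - b p r)) ->
  \sum_(s : {perm 'I_n}) \prod_(i < n) \prod_(j < n | (i < j)%N) (1 + b (s i) (s j)) = (n`!)%:R.
Proof.
elim: n b => [|n IH] b bN b3.
  rewrite (eq_bigr (fun _ => 1)) => [|s _]; last by rewrite big_ord0.
  by rewrite sumr_const card_Sn.
rewrite (partition_big (fun s : {perm 'I_n.+1} => s ord0) predT) //=.
transitivity (\sum_(j : 'I_n.+1) \prod_(q | q != j) (1 + b j q) * (n`!)%:R).
  apply: eq_bigr => j _.
  rewrite -(IH (fun p q => b (lift j p) (lift j q))); last first.
  - by move=> p q r pq pr qr; apply: b3; rewrite (inj_eq lift_inj).
  - by move=> p q; apply: bN.
  rewrite mulr_sumr (reindex (lift_perm ord0 j)); last first.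
    (* [f s] is what s does after the value s(0) is deleted. The default k is never reached, because
       s(k+1) differs from s(0). *)
    pose f (s : {perm 'I_n.+1}) k := odflt k (unlift (s ord0) (s (lift ord0 k))).
    have fK (s : {perm _}) k : lift (s ord0) (f s k) = s (lift ord0 k).
      rewrite /f; have : s (lift ord0 k) != s ord0.
        by rewrite (inj_eq perm_inj) eq_sym neq_lift.
      by rewrite eq_sym => /unlift_some[] ? ? ->.
    have f_inj (s : {perm _}) : injective (f s).
      apply: can_inj (fun k => odflt k (unlift ord0 (s^-1%g (lift (s ord0) k)))) _ => k.
      by rewrite fK permK liftK.
    exists (fun s => perm (f_inj s)) => [s _|s /eqP s0]; apply/permP=> k.
      by rewrite permE /f lift_perm_lift lift_perm_id liftK.
    case: (unliftP ord0 k) => [k'|] ->; rewrite ?lift_perm_id //.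
    by rewrite lift_perm_lift -s0 permE fK.
  apply: eq_big => [s|s _]; first by rewrite lift_perm_id eqxx.
  rewrite big_ord_recl /=; congr (_ * _).
    rewrite big_mkcond big_ord_recl /= mul1r lift_perm_id.
    rewrite [RHS]big_mkcond (bigD1_ord j) //= eqxx mul1r [RHS](reindex_inj (@perm_inj _ s)).
    apply: eq_bigr => q _.
    by rewrite lift_perm_lift eq_sym neq_lift.
  apply: eq_bigr => i _; rewrite big_mkcond big_ord_recl /= mul1r -big_mkcond /=.
  by apply: eq_bigr => q _; rewrite !lift_perm_lift.
rewrite -mulr_suml.
have := @sum_prod_pairs _ b setT bN b3.
under eq_bigl do rewrite inE.
under eq_bigr do under eq_bigl do rewrite inE /=.
move=> ->; rewrite cardsT card_ord factS natrM; ring.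
Qed.
End PermutationIdentity.

(** * The rank permutation r_alpha, rearrangements and dominance *)

Section Ranks.
Variable N : nat.
Implicit Types (a b : mono N) (i j : 'I_N) (w : {perm 'I_N}).

Lemma card_ord_lt m : (m <= N)%N -> #|[pred y : 'I_N | (y < m)%N]| = m.
Proof.
by move=> mN; rewrite -sum1_card (big_ord_narrow mN) sum_nat_const card_ord muln1.
Qed.

(** The value w x is the number of y with w y < w x, so it can be read off the order that w induces
    on its arguments. *)
Lemma perm_ord_eq (u v : {perm 'I_N}) :
  (forall x y, (u x < u y)%N = (v x < v y)%N) -> u = v.
Proof.
have uE (w : {perm 'I_N}) x : #|[pred y | (w y < w x)%N]| = w x.
  rewrite -[RHS](@card_ord_lt (w x)); last exact: ltnW.
  by rewrite -!sum1_card [RHS](reindex_inj (@perm_inj _ w)).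
move=> uv; apply/permP => x; apply: val_inj => /=.
by rewrite -(uE u) -(uE v); apply: eq_card => y; rewrite !inE uv.
Qed.

(** The strict total order on positions that the rank enumerates. Statements about r_alpha are
    reduced to it, where they become arithmetic. *)
Definition precedes a j i := (a i < a j)%N || ((a j == a i) && (j < i)%N).

Lemma rankE a i : rank a i = #|[pred j | precedes a j i]|.+1.
Proof.
rewrite /rank -cardUI [X in (_ + X)%N]eq_card0 ?addn0; last first.
  by move=> j; rewrite !inE /=; lia.
rewrite (cardD1 i) !inE /= ltnn leqnn eqxx /= add1n; congr _.+1.
apply: eq_card => j; rewrite !inE /precedes /=.
have [->|/eqP ji] := eqVneq j i; first by rewrite ltnn eqxx ltnn.
have : nat_of_ord j <> i by move=> /ord_inj.
lia.
Qed.

Lemma rank_lt a i j : (rank a j < rank a i)%N = precedes a j i.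
Proof.
have lt x y : precedes a x y -> (rank a x < rank a y)%N.
  move=> xy; rewrite !rankE ltnS proper_card //; apply/properP; split.
    by apply/subsetP=> z; move: xy; rewrite !inE /precedes; lia.
  by exists x; rewrite !inE // /precedes; lia.
apply/idP/idP => [|/lt //].
have : [|| i == j, precedes a j i | precedes a i j].
  by rewrite /precedes -(inj_eq (@ord_inj N)) /=; lia.
by case/or3P => [/eqP->|//|/lt]; lia.
Qed.

Lemma rank_subproof a i : ((rank a i).-1 < N)%N.
Proof.
rewrite rankE /= -[X in (_ < X)%N]card_ord proper_card //; apply/properP; split.
  exact/subsetP.
by exists i; rewrite // !inE /precedes; lia.
Qed.

Lemma rank_inj a : injective (fun i => Ordinal (rank_subproof a i)).
Proof.
move=> i j /(congr1 val) /= ij.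
have E : rank a i = rank a j by move: ij; rewrite !rankE /= => ->.
have := rank_lt a i j; have := rank_lt a j i; rewrite E ltnn /precedes => h1 h2.
by apply: val_inj => /=; lia.
Qed.

(* The permutation r_alpha with 0-based values, whereas [rank] is 1-based. *)
Definition rank_perm a : {perm 'I_N} := perm (@rank_inj a).

Lemma rank_permE a i : val (rank_perm a i) = (rank a i).-1.
Proof. by rewrite permE. Qed.

Lemma rank_perm_lt a i j : (rank_perm a j < rank_perm a i)%N = precedes a j i.
Proof. by rewrite !rank_permE -rank_lt !rankE. Qed.

Definition permm a w : mono N := [ffun i => a (w i)].

Lemma permm_tpermK a i j : permm (permm a (tperm i j)) (tperm i j) = a.
Proof. by apply/ffunP => x; rewrite !ffunE tpermK. Qed.

Lemma permm_tperm_eq a i j : a i = a j -> permm a (tperm i j) = a.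
Proof. by move=> ij; apply/ffunP => x; rewrite !ffunE; case: tpermP => // ->. Qed.

(** Ties are broken by position. Exchanging two adjacent positions keeps the relative position of
    every other pair, and i, j themselves are not tied. *)
Lemma rank_perm_tperm a i j : j = i.+1 :> nat -> a i != a j ->
  rank_perm (permm a (tperm i j)) = (tperm i j * rank_perm a)%g.
Proof.
move=> ij aij; apply: perm_ord_eq => x y.
rewrite !permM !rank_perm_lt /precedes !ffunE.
move: aij.
have neq (u v : 'I_N) : u <> v -> nat_of_ord u <> v by move=> H /ord_inj.
case: tpermP => [->|->|/neq ? /neq ?]; case: tpermP => [->|->|/neq ? /neq ?]; lia.
Qed.

(** Nothing can be ranked between two adjacent positions with equal exponents. This makes the
    transposition of their ranks a simple reflection, to which Young's formula applies. *)
Lemma rank_perm_next a i j : j = i.+1 :> nat -> a i = a j ->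
  val (rank_perm a j) = (val (rank_perm a i)).+1.
Proof.
move=> ij aij; rewrite !rank_permE !rankE /=.
rewrite (cardD1 i) !inE {1}/precedes aij eqxx ij leqnn orbT add1n; congr _.+1.
apply: eq_card => x; rewrite !inE /precedes aij /=.
have [->|/eqP spectral] := eqVneq x i; first by rewrite /= aij !ltnn andbF.
have : nat_of_ord x <> i by move=> /ord_inj.
lia.
Qed.

Lemma size_seqm a : size (seqm a) = N.
Proof. by rewrite size_map size_enum_ord. Qed.

Lemma nth_seqm a (i : 'I_N) : nth 0%N (seqm a) i = a i.
Proof. by rewrite (nth_map i) ?size_enum_ord // nth_ord_enum. Qed.

Lemma geq_trans : transitive geq.
Proof. by move=> x y z /= ? ?; lia. Qed.

(** Both sides are nonincreasing and list the same entries. *)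
Lemma plusmE a : plusm a = seqm (permm a (rank_perm a)^-1%g).
Proof.
apply: (sorted_eq geq_trans).
- by move=> x y /=; lia.
- by apply: sort_sorted => x y /=; lia.
- apply/(sortedP 0%N) => k; rewrite size_seqm => kN.
  have kN' : (k < N)%N by lia.
  rewrite (nth_seqm _ (Ordinal kN)) (nth_seqm _ (Ordinal kN')) !ffunE /=.
  set x := (_ (Ordinal kN)); set y := (_ (Ordinal kN')).
  have : (rank_perm a y < rank_perm a x)%N by rewrite !permKV.
  by rewrite rank_perm_lt /precedes; lia.
rewrite /plusm perm_sort; apply/(perm_iotaP 0%N).
rewrite /seqm.
have -> : [seq permm a (rank_perm a)^-1%g i | i <- enum 'I_N] =
          [seq a i | i <- [seq (rank_perm a)^-1%g i | i <- enum 'I_N]].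
  by rewrite /seqm -[RHS]map_comp; apply: eq_map => i; rewrite /= ffunE.
apply/(perm_iotaP 0%N); apply: perm_map; apply: uniq_perm.
- exact: enum_uniq.
- by rewrite map_inj_uniq ?enum_uniq //; exact: perm_inj.
move=> i; rewrite mem_enum; symmetry; apply/mapP; exists (rank_perm a i).
  by rewrite mem_enum.
by rewrite permK.
Qed.

Lemma nth_plusm a i : nth 0%N (plusm a) (rank_perm a i) = a i.
Proof. by rewrite plusmE nth_seqm ffunE permK. Qed.

Lemma plusm_eq_permm a b : plusm a = plusm b ->
  b = permm a (rank_perm b * (rank_perm a)^-1)%g.
Proof.
move=> ab; apply/ffunP => i; rewrite ffunE permM -(nth_plusm b) -ab plusmE.
by rewrite nth_seqm ffunE.
Qed.

Lemma plusm_permm a w : plusm (permm a w) = plusm a.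
Proof.
apply/perm_sortP; [by move=> x y /=; lia|exact: geq_trans|by move=> x y /=; lia|].
have -> : seqm (permm a w) = [seq a i | i <- [seq w i | i <- enum 'I_N]].
  by rewrite /seqm -[RHS]map_comp; apply: eq_map => i; rewrite /= ffunE.
apply: perm_map; apply: uniq_perm.
- by rewrite map_inj_uniq ?enum_uniq //; exact: perm_inj.
- exact: enum_uniq.
move=> i; rewrite mem_enum; apply/mapP; exists (w^-1%g i).
  by rewrite mem_enum.
by rewrite permKV.
Qed.

Lemma degm_permm a w : degm (permm a w) = degm a.
Proof.
by rewrite /degm [RHS](reindex_inj (@perm_inj _ w)); apply: eq_bigr => i _; rewrite ffunE.
Qed.

Lemma tri_degm b a : tri b a -> degm b = degm a.
Proof. by case/andP=> /eqP. Qed.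

(** The two compositions have the same rearrangement, so only dominance of the sequences themselves
    is left. It fails at the sum of the first i + 1 entries (0-based i), which the exchange
    increases by a_j - a_i. *)
Lemma tri_swap a i j : j = i.+1 :> nat -> (a i < a j)%N ->
  ~~ tri (permm a (tperm i j)) a.
Proof.
move=> ij aij; apply/negP => /andP[_ /orP[|/andP[_]]]; first by rewrite plusm_permm /domlt eqxx.
case/andP=> _ /allP /(_ i.+1); rewrite mem_iota /= ltnS ltn_ord => /(_ isT).
apply/negP; rewrite -ltnNge /psum !big_ord_recr /= !nth_seqm ffunE tpermL.
rewrite -addnS leq_add // leq_eqVlt; apply/orP; left; apply/eqP.
apply: eq_bigr => x _.
have xN : (x < N)%N by have := ltn_ord x; have := ltn_ord i; lia.
rewrite -[nat_of_ord x]/(nat_of_ord (Ordinal xN)) !nth_seqm ffunE tpermD //;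
 by apply/eqP => /(congr1 val) /=; have := ltn_ord x; lia.
Qed.

Lemma rank_perm_sorted a : (forall i j, (i <= j)%N -> (a j <= a i)%N) -> rank_perm a = 1%g.
Proof.
move=> srt; apply: perm_ord_eq => x y; rewrite rank_perm_lt /precedes !perm1.
by have := srt x y; have := srt y x; lia.
Qed.

Lemma seqm_minusm a : seqm (minusm a) = sort leq (seqm a).
Proof.
apply: (@eq_from_nth _ 0%N); first by rewrite size_sort !size_seqm.
move=> k; rewrite size_seqm => kN.
by rewrite (nth_seqm _ (Ordinal kN)) ffunE.
Qed.

Lemma plusm_minusm a : plusm (minusm a) = plusm a.
Proof.
apply/perm_sortP; [by move=> x y /=; lia|exact: geq_trans|by move=> x y /=; lia|].
by rewrite seqm_minusm perm_sort.
Qed.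

Lemma minusm_sorted a i j : (i <= j)%N -> (minusm a i <= minusm a j)%N.
Proof.
move=> ij; rewrite !ffunE; apply: (sorted_leq_nth leq_trans leqnn) => //.
- exact: sort_sorted leq_total _.
- by rewrite inE size_sort size_seqm.
- by rewrite inE size_sort size_seqm.
Qed.

End Ranks.

(** * Contents of reverse standard tableaux and column-strict fillings *)

Section TableauGeometry.
Variables (N : nat) (sh : seq nat).
Hypothesis sh_part : is_partition N sh.
Implicit Types (T : tab N sh) (c d : 'I_N * 'I_N).

Lemma tab_inj T : injective (val T).
Proof. by case: T => t /= /and4P[/injectiveP]. Qed.

Lemma tab_diag T k : in_diag sh (val T k).
Proof. by case: T => t /= /and4P[_ /forallP]. Qed.

Lemma tab_row T k l : (val T k).1 = (val T l).1 ->
  ((val T k).2 < (val T l).2)%N -> (l < k)%N.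
Proof.
case: T => t /= /and4P[_ _ /forallP /(_ k) /forallP /(_ l) /implyP h _] h1 h2.
by apply: h; rewrite h1 eqxx.
Qed.

Lemma tab_col T k l : (val T k).2 = (val T l).2 ->
  ((val T k).1 < (val T l).1)%N -> (l < k)%N.
Proof.
case: T => t /= /and4P[_ _ _ /forallP /(_ k) /forallP /(_ l) /implyP h] h1 h2.
by apply: h; rewrite h1 eqxx.
Qed.

Lemma nth_sh_le r r' : (r <= r')%N -> (nth 0%N sh r' <= nth 0%N sh r)%N.
Proof.
move=> rr; case/andP: sh_part => /andP[srt _] _.
have [big|lt] := leqP (size sh) r'; first by rewrite nth_default.
by apply: (sorted_leq_nth geq_trans leqnn 0%N srt) => //; rewrite inE; apply: leq_ltn_trans lt.
Qed.

Lemma in_diag_le c d : (d.1 <= c.1)%N -> (d.2 <= c.2)%N -> in_diag sh c -> in_diag sh d.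
Proof. by rewrite /in_diag => /nth_sh_le; lia. Qed.

Definition onto_diag (T : tab N sh) := forall c, in_diag sh c -> exists k, val T k = c.

(** If one tableau covers the diagram, the diagram has N cells, and injectivity makes every other
    tableau cover it too. *)
Lemma onto_diag_all T T' : onto_diag T -> onto_diag T'.
Proof.
move=> sT; pose D := [set c : 'I_N * 'I_N | in_diag sh c].
have imT : [set val T k | k in 'I_N] = D.
  apply/setP => c; rewrite inE; apply/imsetP/idP => [[k _ ->]|/sT[k <-]].
    exact: tab_diag.
  by exists k.
have cD : #|D| = N by rewrite -imT card_imset ?card_ord //; apply: tab_inj.
have imT' : [set val T' k | k in 'I_N] = D.
  apply/eqP; rewrite eqEcard cD card_imset ?card_ord ?leqnn ?andbT; last exact: tab_inj.
  by apply/subsetP => c /imsetP[k _ ->]; rewrite inE tab_diag.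
by move=> c cd; have : c \in D by [rewrite inE]; rewrite -imT' => /imsetP[k _ ->]; exists k.
Qed.

Hypothesis onto : forall T, onto_diag T.

(** The cell in the row of k and the column of l lies in the diagram. Its entry is compared with k
    along the row and with l along the column. *)
Lemma tab_le T k l : ((val T k).1 <= (val T l).1)%N -> ((val T k).2 <= (val T l).2)%N ->
  (l <= k)%N.
Proof.
move=> h1 h2; have [|m hm] := @onto T ((val T k).1, (val T l).2).
  by apply: in_diag_le (tab_diag T l).
have lm : (l <= m)%N.
  have := @tab_col T m l; rewrite hm /= => /(_ erefl) H.
  move: h1; rewrite leq_eqVlt => /orP[/eqP E|/H /ltnW //].
  have -> // : m = l; apply: (@tab_inj T); rewrite hm (ord_inj E); by case: (val T l).
apply: leq_trans lm _.
have := @tab_row T k m; rewrite hm /= => /(_ erefl) H.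
move: h2; rewrite leq_eqVlt => /orP[/eqP E|/H /ltnW //].
have -> // : m = k; apply: (@tab_inj T); rewrite hm -(ord_inj E); by case: (val T k).
Qed.

(** Cells of equal content lie on one diagonal, and the upper right corner of the rectangle they
    span holds an entry that is smaller than the upper left one and larger than the lower right one.
    Consecutive entries leave no room for it. *)
Lemma contz_next T (i j : 'I_N) : j = i.+1 :> nat -> contz T i != contz T j.
Proof.
move=> ij; apply/eqP; rewrite /contz => E.
have [h|h|h] := ltngtP (val T i).1 (val T j).1; last first.
- have : i = j; last by move=> e; move: ij; rewrite e; lia.
  apply: (@tab_inj T); case: (val T i) (val T j) h E => [a b] [a' b'] /= /ord_inj -> E.
  by congr pair; apply: ord_inj; lia.
- have E2 : ((val T j).2 < (val T i).2)%N by lia.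
  have [|m hm] := @onto T ((val T j).1, (val T i).2).
    by apply: in_diag_le (tab_diag T i) => //=; exact: ltnW.
  have := @tab_row T j m; have := @tab_col T m i; rewrite hm /= => /(_ erefl) H1 /(_ erefl) H2.
  by have := H1 h; have := H2 E2; lia.
have E2 : ((val T i).2 < (val T j).2)%N by lia.
have [|m hm] := @onto T ((val T i).1, (val T j).2).
  by apply: in_diag_le (tab_diag T j) => //=; exact: ltnW.
have := @tab_row T i m; have := @tab_col T m j; rewrite hm /= => /(_ erefl) H1 /(_ erefl) H2.
by have := H1 h; have := H2 E2; lia.
Qed.

(** Entries decrease to the right and downwards, so the largest one sits in the corner (0, 0). *)
Lemma contz_last T (i : 'I_N) : i = N.-1 :> nat -> contz T i = 0.
Proof.
move=> iN; have N0 : (0 < N)%N by apply: leq_ltn_trans (ltn_ord i).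
have [|m hm] := @onto T (Ordinal N0, Ordinal N0).
  by apply: in_diag_le (tab_diag T i).
have im : (i <= m)%N by apply: (@tab_le T); rewrite hm.
have -> : i = m by apply: ord_inj; have := ltn_ord m; lia.
by rewrite /contz hm.
Qed.

(** Contents run from 1 - l(tau) to tau_1 - 1, so two of them differ by at most h_tau - 1. The
    remaining slack of one is spent in [swap_coef_neq0]. *)
Lemma contz_bound T T' (i j : 'I_N) : `|contz T i - contz T' j| < (hook sh)%:Z.
Proof.
have bnd (U : tab N sh) k : ((val U k).1 < size sh)%N && ((val U k).2 < head 0%N sh)%N.
  have := tab_diag U k; rewrite /in_diag => h.
  have := @nth_sh_le 0 (val U k).1 (leq0n _); rewrite nth0 => h'.
  apply/andP; split; last exact: leq_trans h h'.
  by rewrite ltnNge; apply/negP => big; move: h; rewrite nth_default.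
have := bnd T i; have := bnd T' j; rewrite /contz /hook; lia.
Qed.

Lemma colstrict_col (F : 'I_N * 'I_N -> nat) (r r' c : 'I_N) :
  colstrict sh F -> (r < r')%N -> in_diag sh (r', c) -> (F (r, c) < F (r', c))%N.
Proof.
move=> [cF _]; have [n] := ubnP (r' : nat).
elim: n r' => // n IH r' /ltnSE rn rr d.
have pN : (r'.-1 < N)%N by have := ltn_ord r'; lia.
have st := cF (Ordinal pN) r' c ltac:(rewrite /=; lia) d.
have [E|ne] := eqVneq r (Ordinal pN); first by rewrite E.
apply: ltn_trans st; apply: IH => /=; first lia.
  have : nat_of_ord r <> r'.-1 by move=> E; case/eqP: ne; apply: ord_inj.
  lia.
by apply: in_diag_le d => //=; lia.
Qed.

Lemma colstrict_row (F : 'I_N * 'I_N -> nat) (r c c' : 'I_N) :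
  colstrict sh F -> (c <= c')%N -> in_diag sh (r, c') -> (F (r, c) <= F (r, c'))%N.
Proof.
move=> [_ cF]; have [n] := ubnP (c' : nat).
elim: n c' => // n IH c' /ltnSE rn rr d.
have [->//|ne'] := eqVneq c c'.
have ne : nat_of_ord c <> c' by move=> E; case/eqP: ne'; apply: ord_inj.
have pN : (c'.-1 < N)%N by have := ltn_ord c'; lia.
have st := cF r (Ordinal pN) c' ltac:(rewrite /=; lia) d.
apply: leq_trans st; apply: IH => /=; try lia.
by apply: in_diag_le d => //=; lia.
Qed.

(** Equal entries form a horizontal strip: were d weakly to the right of c, the cell in the row of d
    and the column of c would have an entry larger than that of c and at most that of d. *)
Lemma colstrict_strip (F : 'I_N * 'I_N -> nat) c d :
  colstrict sh F -> in_diag sh d -> F c = F d -> (c.1 < d.1)%N -> (d.2 < c.2)%N.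
Proof.
move=> cF dd E lt; rewrite ltnNge; apply/negP => le.
case: c d dd E lt le => [r c] [r' c'] /= dd E lt le.
have := @colstrict_col F r r' c cF lt (@in_diag_le (r', c') (r', c) (leqnn _) le dd).
have := @colstrict_row F r' c c' cF le dd; lia.
Qed.

End TableauGeometry.

Lemma vec_ext (C : numClosedFieldType) N sh (v w : vec C N sh) : v =1 w -> v = w.
Proof. exact: functional_extensionality. Qed.

(** * Jucys--Murphy elements are diagonal in Young's basis *)

Section YoungRepresentation.
Variables (C : numClosedFieldType) (N : nat) (sh : seq nat).
Hypothesis sh_part : is_partition N sh.
Hypothesis onto : forall T : tab N sh, onto_diag T.
Variable rho : {perm 'I_N} -> vmat C N sh.
Hypothesis rhoP : is_young_rep rho.
Local Notation vz := (@vzero C N sh).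
Implicit Types (v w : vec C N sh) (M : vmat C N sh).

Lemma mappDZ M a v w :
  mapp M (fun T => a * v T + w T) = fun U => a * mapp M v U + mapp M w U.
Proof.
apply: vec_ext => U; rewrite /mapp mulr_sumr -big_split /=.
by apply: eq_bigr => T _; ring.
Qed.

Lemma mapp0 M : mapp M (vz) = vz.
Proof. by apply: vec_ext => U; rewrite /mapp big1 // => T _; rewrite mulr0. Qed.

Lemma mappZ M a v : mapp M (fun T => a * v T) = fun U => a * mapp M v U.
Proof. by apply: vec_ext => U; rewrite /mapp mulr_sumr; apply: eq_bigr => T _; ring. Qed.

Lemma mappD M v w :
  mapp M (fun T => v T + w T) = fun U => mapp M v U + mapp M w U.
Proof.
by apply: vec_ext => U; rewrite /mapp -big_split /=; apply: eq_bigr => T _; ring.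
Qed.

Lemma mapp_sum (I : finType) (P : pred I) M (f : I -> vec C N sh) :
  mapp M (fun T => \sum_(i | P i) f i T) =
  fun U => \sum_(i | P i) mapp M (f i) U.
Proof.
apply: vec_ext => U; rewrite /mapp exchange_big /=.
by apply: eq_bigr => T _; rewrite mulr_sumr.
Qed.

Lemma mapp_tbasis M T : mapp M (tbasis C T) = fun U => M U T.
Proof.
apply: vec_ext => U; rewrite /mapp (bigD1 T) //= /tbasis eqxx mulr1 big1 ?addr0 //.
by move=> T' /negbTE->; rewrite mulr0.
Qed.

Lemma mapp_rhoM s t v :
  mapp (rho (s * t)%g) v = mapp (rho t) (mapp (rho s) v).
Proof.
apply: vec_ext => U; case: rhoP => _ -> _; rewrite /mapp /mmul.
under eq_bigr do rewrite mulr_suml.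
rewrite exchange_big /=; apply: eq_bigr => T _.
by rewrite mulr_sumr; apply: eq_bigr => T' _; rewrite mulrA.
Qed.

Lemma mapp_rho1 v : mapp (rho 1%g) v = v.
Proof.
apply: vec_ext => U; case: rhoP => -> _ _; rewrite /mapp /idm (bigD1 U) //= eqxx mul1r.
by rewrite big1 ?addr0 // => T /negbTE; rewrite eq_sym => ->; rewrite mul0r.
Qed.

Lemma mapp_rhoK s v : mapp (rho s^-1%g) (mapp (rho s) v) = v.
Proof. by rewrite -mapp_rhoM mulgV mapp_rho1. Qed.

(** The sum runs over the larger indices because the tableaux are reverse standard: the last index
    has content 0 and an empty sum. *)
Definition jucys_murphy (i : 'I_N) v : vec C N sh :=
  fun U => \sum_(j < N | (i < j)%N) mapp (rho (tperm i j)) v U.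

Lemma jucys_murphyDZ i a v w : jucys_murphy i (fun T => a * v T + w T) = fun U => a * jucys_murphy i v U + jucys_murphy i w U.
Proof.
apply: vec_ext => U; rewrite /jucys_murphy mulr_sumr -big_split /=.
by apply: eq_bigr => j _; rewrite mappDZ.
Qed.

(** This is omega_i = s_i + s_i omega_j s_i: conjugation by s_i turns (j l) into (i l) for every l >
    j, and the transposition (i j) is left over. *)
Lemma jucys_murphy_rec (i j : 'I_N) v : j = i.+1 :> nat ->
  jucys_murphy i v = fun U => mapp (rho (tperm i j)) v U +
    mapp (rho (tperm i j)) (jucys_murphy j (mapp (rho (tperm i j)) v)) U.
Proof.
move=> ij; apply: vec_ext => U; rewrite /jucys_murphy (bigD1 j) ?ij //=; congr (_ + _).
rewrite mapp_sum; apply: eq_big => l.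
  by apply/andP/idP => [[il /eqP lj]|jl]; [have : nat_of_ord l <> j by move=> /ord_inj|split];
    rewrite -?(inj_eq val_inj) /=; lia.
move=> /andP[il lj]; rewrite -!mapp_rhoM; congr (mapp (rho _) v U).
have -> : tperm i l = (tperm j l ^ tperm i j)%g.
  rewrite tpermJ tpermR tpermD //; last by rewrite eq_sym.
  by apply: contraTneq il => ->; rewrite ltnn.
by rewrite conjgE tpermV ?mulgA.
Qed.

(** Induction downwards from the last index. With s T = T/c + w from Young's formula, both T and w
    are eigenvectors of omega_j, and the recursion gives omega_i. *)
Lemma jucys_murphy_tbasis i T :
  jucys_murphy i (tbasis C T) = fun U => (contz T i)%:~R * tbasis C T U.
Proof.
have [n] := ubnP (N - i)%N; elim: n i T => // n IH i T /ltnSE le.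
have [iN|iN] := eqVneq (nat_of_ord i) N.-1.
  rewrite (contz_last sh_part onto T iN); apply: vec_ext => U; rewrite mul0r /jucys_murphy big1 // => j.
  have := ltn_ord j; lia.
have jN : (i.+1 < N)%N by have := ltn_ord i; lia.
pose j := Ordinal jN; have ij : j = i.+1 :> nat by [].
have {}IH T' : jucys_murphy j (tbasis C T') = fun U => (contz T' j)%:~R * tbasis C T' U.
  by apply: IH => /=; have := ltn_ord i; lia.
set sw := [ffun l => val T (tperm i j l)].
set c := (contz T i - contz T j)%:~R : C.
have c0 : c != 0 by rewrite intr_eq0 subr_eq0 (contz_next sh_part onto).
pose x : C := if (2 <= contz T i - contz T j)%R then 1 else
  if (contz T i - contz T j <= -2)%R then 1 - c^-2 else 0.
pose w : vec C N sh := fun U => if val U == sw then x else 0.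
have sT : mapp (rho (tperm i j)) (tbasis C T) = fun U => c^-1 * tbasis C T U + w U.
  apply: vec_ext => U; rewrite mapp_tbasis; case: rhoP => _ _ -> //.
  rewrite /Ms -/sw -/c -/x /w /tbasis; case: eqP => _; rewrite ?mulr1 ?mulr0 //.
(* w is a multiple of the tableau with i and j exchanged, in which j has the content that i has in
   T. It is zero if the exchange does not give a tableau. *)
have jw : jucys_murphy j w = fun U => (contz T i)%:~R * w U.
  case: (pickP [pred T' : tab N sh | val T' == sw]) => [T' /eqP E|none].
    have wE : w = fun U => x * tbasis C T' U + vz U.
      apply: vec_ext => U; rewrite /w -E (inj_eq val_inj) /tbasis /vzero addr0.
      by case: eqP => _; rewrite ?mulr1 ?mulr0.
    have ci : contz T' j = contz T i by rewrite /contz E ffunE tpermR.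
    rewrite wE jucys_murphyDZ IH ci; apply: vec_ext => U.
    by rewrite /jucys_murphy big1 => [|l _]; rewrite ?mapp0 // /vzero; ring.
  have -> : w = vz by apply: vec_ext => U; have := none U; rewrite /w /= => ->.
  by apply: vec_ext => U; rewrite /jucys_murphy big1 => [|l _]; rewrite ?mapp0 // /vzero mulr0.
have w_eq : w = fun U => - c^-1 * tbasis C T U + mapp (rho (tperm i j)) (tbasis C T) U.
  by apply: vec_ext => U; rewrite sT; ring.
have ss v : mapp (rho (tperm i j)) (mapp (rho (tperm i j)) v) = v.
  by rewrite -{1}(tpermV i j) mapp_rhoK.
rewrite (jucys_murphy_rec _ ij) sT jucys_murphyDZ IH jw.
(* As w = sT - T/c and c(j) = c(i) - c, the argument of s becomes -T + c(i) sT. Applying s yields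
   -sT + c(i) T, whose first term cancels the sT in front. *)
have -> : (fun U => c^-1 * ((contz T j)%:~R * tbasis C T U) + (contz T i)%:~R * w U) =
          (fun U => -1 * tbasis C T U + (contz T i)%:~R *
             mapp (rho (tperm i j)) (tbasis C T) U).
  apply: vec_ext => U; rewrite w_eq.
  have -> : (contz T j)%:~R = (contz T i)%:~R - c by rewrite /c intrB opprB addrC subrK.
  have aux (a b t m : C) : b != 0 -> b^-1 * ((a - b) * t) + a * (- b^-1 * t + m) = -1 * t + a * m.
    by move=> b0; field.
  exact: aux.
rewrite mappDZ mappZ ss sT; apply: vec_ext => U; ring.
Qed.

Lemma jucys_murphyE i v U : jucys_murphy i v U = (contz U i)%:~R * v U.
Proof.
transitivity (\sum_T v T * jucys_murphy i (tbasis C T) U).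
  rewrite /jucys_murphy /mapp exchange_big /=; under [RHS]eq_bigr do rewrite mulr_sumr.
  rewrite [RHS]exchange_big /= exchange_big /=; apply: eq_bigr => j _; apply: eq_bigr => T _.
  rewrite -/(mapp (rho (tperm i j)) (tbasis C T) U) mapp_tbasis; exact: mulrC.
rewrite (bigD1 U) //= big1 ?addr0 => [|T TU].
  by rewrite jucys_murphy_tbasis /tbasis eqxx mulr1 mulrC.
by rewrite jucys_murphy_tbasis /tbasis eq_sym (negbTE TU) !mulr0.
Qed.

End YoungRepresentation.

(** * Dunkl operators, triangularity of U_i and the relations with s_i *)

Section Operators.
Variables (C : numClosedFieldType) (N : nat) (sh : seq nat) (k : C).
Variable rho : {perm 'I_N} -> vmat C N sh.
Hypothesis rhoP : is_young_rep rho.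
Local Notation vz := (@vzero C N sh).
Implicit Types (p q : vpoly C N sh) (a b c : mono N) (i j : 'I_N) (w : {perm 'I_N}).

Lemma vpoly_ext p q : (forall b T, p b T = q b T) -> p = q.
Proof. by move=> pq; apply: functional_extensionality => b; apply: vec_ext => T. Qed.

Definition decr b i : mono N := [ffun l => if l == i then (b l).-1 else b l].

(** Additive form, free of subtraction in nat. It serves the degree and the two statistics of the
    triangularity order. *)
Lemma sum_upd2 (f : 'I_N -> nat -> nat) b i j x y : i != j ->
  (\sum_(l < N) f l (upd2 b i x j y l) + (f i (b i) + f j (b j)) =
   \sum_(l < N) f l (b l) + (f i x + f j y))%N.
Proof.
move=> ij; rewrite (bigD1 i) // (bigD1 j) 1?eq_sym //= [in RHS](bigD1 i) // [in RHS](bigD1 j) 1?eq_sym //=.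
rewrite !ffunE !eqxx eq_sym (negbTE ij).
rewrite (eq_bigr (fun l => f l (b l))); first lia.
by move=> l /andP[/negbTE li /negbTE lj]; rewrite ffunE li lj.
Qed.

Lemma permm_upd2 b i j : permm b (tperm i j) = upd2 b i (b j) j (b i).
Proof.
apply/ffunP => l; rewrite !ffunE; case: tpermP => [->|->|/eqP/negbTE -> /eqP/negbTE ->] //.
  by rewrite eqxx.
by rewrite eqxx; case: eqP => [->|].
Qed.

Lemma upd2_id b i j : upd2 b i (b i) j (b j) = b.
Proof. by apply/ffunP => l; rewrite !ffunE; do 2?case: eqP => [->|_]. Qed.

(** In this form triangularity is visible: every exponent pair with nonzero sign has maximum at
    least max(b_i, b_j), with equality only for a = max(b_i, b_j). *)
Lemma dd_mulx i j p b T : i != j ->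
  dd i j (mulx i p) b T = \sum_(0 <= a < (b i + b j).+1)
    (if (maxn (b i) (b j) <= a)%N then 1 else if (a < minn (b i) (b j))%N then -1 else 0) *
    p (upd2 b i a j (b i + b j - a)) T.
Proof.
move=> ij; rewrite /dd big_ord_recl /= {1}/mulx ffunE eqxx /= mulr0 add0r big_mkord.
apply: eq_bigr => a _; rewrite /mulx ffunE eqxx /bump /= add1n; congr (_ * _).
  by rewrite /ddc; have := ltn_ord a; do ![case: ifP => ?]; first [by []|lia].
congr (p _ T); apply/ffunP => l; rewrite !ffunE.
by rewrite subSS; case: (l == i).
Qed.

Lemma mulx_dd i j p b T : i != j ->
  mulx i (dd i j p) b T = \sum_(0 <= a < (b i + b j).+1)
    (if (0 < b i)%N then ddc C a (b i + b j - a) (b i).-1 else 0) *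
    p (upd2 b i a j (b i + b j - a)) T.
Proof.
move=> ij; rewrite /mulx; case: ifP => bi; last first.
  by rewrite big1 // => a _; rewrite mul0r.
rewrite /dd !ffunE eqxx eq_sym (negbTE ij).
have -> : ((b i).-1 + b j = (b i + b j).-1)%N by lia.
rewrite -(big_mkord xpredT (fun a : nat => ddc C a ((b i + b j).-1.+1 - a) (b i).-1 *
  p (upd2 (decr b i) i a j ((b i + b j).-1.+1 - a)) T)).
rewrite !prednK ?addn_gt0 ?bi //; apply: eq_bigr => a _; congr (_ * p _ T).
by apply/ffunP => l; rewrite !ffunE; case: eqVneq.
Qed.

(** Divide x_i p - x_j p(x(i,j)) = x_i (p - p(x(i,j))) + (x_i - x_j) p(x(i,j)) by x_i - x_j. The
    verification is coefficientwise. *)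
Lemma dd_mulx_comm i j p b T : i != j ->
  dd i j (mulx i p) b T = mulx i (dd i j p) b T + p (permm b (tperm i j)) T.
Proof.
move=> ij; rewrite dd_mulx // mulx_dd // permm_upd2.
have -> : p (upd2 b i (b j) j (b i)) T = \sum_(0 <= a < (b i + b j).+1)
    (a == b j)%:R * p (upd2 b i a j (b i + b j - a)) T.
  have bj : (b j < (b i + b j).+1)%N by lia.
  rewrite big_mkord (bigD1 (Ordinal bj)) //= eqxx mul1r addnK big1 ?addr0 //.
  by move=> a; rewrite -(inj_eq val_inj) /= => /negbTE ->; rewrite mul0r.
rewrite -big_split /=; apply: eq_big_nat => a ab; rewrite -mulrDl; congr (_ * _).
rewrite /ddc; case: eqP => ?; do ![case: ifP => ?]; rewrite ?addr0 ?add0r ?addNr; first [by []|lia].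
Qed.

(** Moving x_i to the left of D_i produces p and kappa times the sum of (i,j)p over all j != i,
    whose part j < i is cancelled. Here x_i D_i is equivariant, and the form makes it self-adjoint,
    so only the sum over j > i needs attention afterwards. *)
Lemma UopE i p b T : Uop k rho i p b T =
  mulx i (Dunkl k rho i p) b T + p b T +
  k * \sum_(j < N | (i < j)%N) pact rho (tperm i j) p b T.
Proof.
rewrite /Uop /Dunkl.
have -> : dpart i (mulx i p) b T = mulx i (dpart i p) b T + p b T.
  have E : [ffun l => if l == i then ([ffun l0 => if l0 == i then (b l0).+1 else b l0] l).-1
      else [ffun l0 => if l0 == i then (b l0).+1 else b l0] l] = b :> mono N.
    by apply/ffunP => l; rewrite !ffunE; case: eqP => // ->; rewrite eqxx.
  rewrite /dpart /mulx ffunE eqxx /= E ffunE eqxx; case: ifP => bi.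
    have -> : [ffun l => if l == i then ([ffun l0 => if l0 == i then (b l0).-1 else b l0] l).+1
      else [ffun l0 => if l0 == i then (b l0).-1 else b l0] l] = b :> mono N.
      by apply/ffunP => l; rewrite !ffunE; case: eqP => // ->; rewrite prednK.
    by rewrite prednK // -natr1; ring.
  have -> : b i = 0%N by lia.
  by rewrite mul1r add0r.
have -> : mulx i (fun b T => dpart i p b T + k * \sum_(j < N | j != i)
    mapp (rho (tperm i j)) (dd i j p b) T) b T =
  mulx i (dpart i p) b T + k * \sum_(j < N | j != i)
    mapp (rho (tperm i j)) (mulx i (dd i j p) b) T.
  rewrite /mulx; case: ifP => // _; rewrite big1 ?mulr0 ?addr0 // => j _.
  by rewrite mapp0.
have -> : \sum_(j < N | j != i) mapp (rho (tperm i j)) (dd i j (mulx i p) b) T =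
  \sum_(j < N | j != i) mapp (rho (tperm i j)) (mulx i (dd i j p) b) T +
  (\sum_(j < N | (j < i)%N) pact rho (tperm i j) p b T +
   \sum_(j < N | (i < j)%N) pact rho (tperm i j) p b T).
  have -> : \sum_(j < N | (j < i)%N) pact rho (tperm i j) p b T +
     \sum_(j < N | (i < j)%N) pact rho (tperm i j) p b T =
     \sum_(j < N | j != i) pact rho (tperm i j) p b T.
    rewrite [RHS](bigID (fun j => (j < i)%N)) /=; congr (_ + _); apply: eq_bigl => j.
      by rewrite -(inj_eq val_inj) /=; case: ltngtP.
    by rewrite -(inj_eq val_inj) /=; case: ltngtP.
  rewrite -big_split /=; apply: eq_bigr => j ji.
  rewrite /pact -[RHS]/((fun U => mapp _ _ U + mapp _ _ U) T) -mappD; congr (mapp _ _ T).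
  by apply: vec_ext => U; rewrite dd_mulx_comm 1?eq_sym.
rewrite -/(pact _ _ _); ring.
Qed.

(* The triangularity of U_i is used with respect to the order (sum b_i^2, sum (N - i) b_i)
   instead of [tri]: spreading two exponents apart raises the first entry, moving
   a larger exponent forward keeps it and raises the second one. *)
Definition sqm b := (\sum_(l < N) b l ^ 2)%N.
Definition wtm b := (\sum_(l < N) (N - l) * b l)%N.
Definition above b c := degm c = degm b /\
  ((sqm b < sqm c)%N \/ sqm c = sqm b /\ (wtm b < wtm c)%N).

Lemma above_spread b i j x y : i != j -> (x + y = b i + b j)%N ->
  (maxn (b i) (b j) < maxn x y)%N -> above b (upd2 b i x j y).
Proof.
move=> ij xy mx; split.
  by have := sum_upd2 (fun _ m => m) b x y ij; rewrite /degm; lia.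
left; have := sum_upd2 (fun _ m => m ^ 2)%N b x y ij; rewrite /sqm.
have : (b i ^ 2 + b j ^ 2 < x ^ 2 + y ^ 2)%N by rewrite -!mulnn; nia.
lia.
Qed.

Lemma above_swap b i j : (i < j)%N -> (b i < b j)%N -> above b (permm b (tperm i j)).
Proof.
move=> lt bij; have ij : i != j by apply: contraTneq lt => ->; rewrite ltnn.
rewrite permm_upd2; split.
  by have := sum_upd2 (fun _ m => m) b (b j) (b i) ij; rewrite /degm; lia.
right; split.
  by have := sum_upd2 (fun _ m => m ^ 2)%N b (b j) (b i) ij; rewrite /sqm; lia.
have := sum_upd2 (fun l m => (N - l) * m)%N b (b j) (b i) ij; rewrite /wtm.
have := ltn_ord i; have := ltn_ord j; nia.
Qed.

(** All terms of [dd_mulx] except a = max(b_i, b_j) spread the two exponents apart, hence vanish. *)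
Lemma dd_lead i j p b : i != j -> (forall c, above b c -> p c = vz) ->
  dd i j (mulx i p) b = if (b j <= b i)%N then p b else p (permm b (tperm i j)).
Proof.
move=> ij top; apply: vec_ext => T; rewrite dd_mulx //.
have mx : (maxn (b i) (b j) < (b i + b j).+1)%N by lia.
rewrite big_mkord (bigD1 (Ordinal mx)) //= leqnn mul1r big1 ?addr0.
  case: leqP => bij.
    by rewrite addKn upd2_id.
  by rewrite addnK permm_upd2.
move=> a; rewrite -(inj_eq val_inj) /= => am; have := ltn_ord a => aS.
case: ifP => h1.
  rewrite top ?mulr0 //; apply: above_spread => //; lia.
case: ifP => h2; last by rewrite mul0r.
by rewrite top ?mulr0 //; apply: above_spread => //; lia.
Qed.

(** Compare the two sums in U_i for each j. If b_j < b_i, the divided difference gives p b and the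
    exchanged coefficient, if present, is above b. In a tie the terms cancel for j < i. If b_j >
    b_i, they cancel for j < i and vanish for j > i. What remains are the j ranked after i. *)
Lemma Uop_lead i p b T : (forall c, above b c -> p c = vz) ->
  Uop k rho i p b T = ((b i)%:R + 1) * p b T +
    k * \sum_(j | precedes b i j) mapp (rho (tperm i j)) (p b) T.
Proof.
move=> top; rewrite /Uop /Dunkl.
have -> : dpart i (mulx i p) b T = ((b i)%:R + 1) * p b T.
  rewrite /dpart /mulx ffunE eqxx /= natr1; congr (_ * p _ T).
  by apply/ffunP => l; rewrite !ffunE; case: eqP => // ->; rewrite eqxx.
rewrite -addrA -mulrBr; congr (_ + _ * _).
rewrite [X in _ - X]big_mkcond [X in X - _]big_mkcond [RHS]big_mkcond /= -sumrB.
apply: eq_bigr => j _; have [->|ji] := eqVneq j i.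
  by rewrite /precedes !ltnn eqxx subr0.
rewrite dd_lead 1?eq_sym // /pvar /precedes -/(permm b (tperm i j)).
have nij : nat_of_ord j <> i by move=> /ord_inj E; rewrite E eqxx in ji.
have [bij|bij] := leqP (b j) (b i); last first.
  have -> /= : (b i == b j) = false by lia.
  have -> /= : (b j < b i)%N = false by lia.
  case: ifP => lt; first by rewrite subrr.
  by rewrite top ?mapp0 ?subr0 //; apply: above_swap => //; lia.
have [E|ne] := eqVneq (b i) (b j).
  rewrite permm_tperm_eq // E ltnn /=.
  case: ltngtP => h; rewrite ?subrr ?subr0 //; lia.
have -> /= : (b j < b i)%N by lia.
case: ifP => lt; last by rewrite subr0.
by rewrite tpermC (top (permm b (tperm j i))) ?mapp0 ?subr0 //; apply: above_swap => //; lia.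
Qed.

Lemma pactM s t p : pact rho s (pact rho t p) = pact rho (t * s)%g p.
Proof.
apply: vpoly_ext => b T; rewrite /pact /pvar (mapp_rhoM rhoP); congr (mapp _ (mapp _ (p _)) T).
by apply/ffunP => i; rewrite !ffunE permM.
Qed.

Lemma pact1 p : pact rho 1%g p = p.
Proof.
apply: vpoly_ext => b T; rewrite /pact /pvar (mapp_rho1 rhoP); congr (p _ T).
by apply/ffunP => i; rewrite !ffunE perm1.
Qed.

Lemma pact_mulx w i p : pact rho w (mulx i p) = mulx (w i) (pact rho w p).
Proof.
apply: vpoly_ext => b T; rewrite /mulx /pact /pvar ffunE.
case: ifP => _; last by rewrite mapp0.
congr (mapp _ (p _) T); apply/ffunP => l; rewrite !ffunE.
by rewrite (inj_eq perm_inj).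
Qed.

Lemma pact_Dunkl w i p : pact rho w (Dunkl k rho i p) = Dunkl k rho (w i) (pact rho w p).
Proof.
apply: vpoly_ext => b T; rewrite {1}/pact /pvar /Dunkl.
have -> : (fun T0 => dpart i p [ffun i0 => b (w i0)] T0 +
    k * (\sum_(j < N | j != i) mapp (rho (tperm i j)) (dd i j p [ffun i0 => b (w i0)]) T0)) =
  (fun T0 => k * (\sum_(j < N | j != i) mapp (rho (tperm i j)) (dd i j p [ffun i0 => b (w i0)]) T0) +
     dpart i p [ffun i0 => b (w i0)] T0) by apply: vec_ext => U; rewrite addrC.
rewrite mappDZ mapp_sum addrC; congr (_ + _ * _).
  rewrite /dpart mappZ ffunE; congr (_ * _); congr (mapp _ (p _) T).
  by apply/ffunP => l; rewrite !ffunE (inj_eq perm_inj).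
rewrite [RHS](reindex_inj (@perm_inj _ w)); apply: eq_big => j.
  by rewrite (inj_eq perm_inj).
move=> ji; rewrite -(mapp_rhoM rhoP).
have -> : (tperm i j * w)%g = (w * tperm (w i) (w j))%g.
  by rewrite -tpermJ conjgE mulKVg.
rewrite (mapp_rhoM rhoP); congr (mapp _ _ T).
have -> : dd (w i) (w j) (pact rho w p) b =
  fun U => \sum_(a < (b (w i) + b (w j)).+2) mapp (rho w)
     (fun U => ddc C a ((b (w i) + b (w j)).+1 - a) (b (w i)) *
       p (upd2 [ffun i0 => b (w i0)] i a j ((b (w i) + b (w j)).+1 - a)) U) U.
  apply: vec_ext => U; rewrite /dd; apply: eq_bigr => a _; rewrite mappZ; congr (_ * _).
  rewrite /pact /pvar; congr (mapp _ (p _) U).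
  by apply/ffunP => l; rewrite !ffunE !(inj_eq perm_inj).
by rewrite -mapp_sum; congr mapp; apply: vec_ext => U; rewrite /dd !ffunE.
Qed.

(** The cross relation of the degenerate affine Hecke algebra. In [UopE] only the sum over l > m is
    not equivariant, and exchanging i with i + 1 affects it only through the transposition (i j),
    for m = i and m = j. *)
Lemma Uop_pact (i j m : 'I_N) p b T : j = i.+1 :> nat ->
  Uop k rho m (pact rho (tperm i j) p) b T =
  pact rho (tperm i j) (Uop k rho (tperm i j m) p) b T +
  (if m == i then k * p b T else if m == j then - (k * p b T) else 0).
Proof.
move=> ij; set s := tperm i j; have sK l : s (s l) = l by rewrite tpermK.
rewrite UopE.
have -> : Uop k rho (s m) p = fun b T => k * (\sum_(l < N | (s m < l)%N) pact rho (tperm (s m) l) p b T)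
    + (mulx (s m) (Dunkl k rho (s m) p) b T + p b T).
  by apply: vpoly_ext => c U; rewrite UopE addrC.
rewrite [X in _ = X + _]/pact /pvar mappDZ mapp_sum mappD.
have -> : mapp (rho s) (mulx (s m) (Dunkl k rho (s m) p) [ffun i0 => b (s i0)]) T =
   mulx m (Dunkl k rho m (pact rho s p)) b T.
  by rewrite -[LHS]/(pact rho s (mulx (s m) (Dunkl k rho (s m) p)) b T) pact_mulx pact_Dunkl sK.
rewrite -[mapp (rho s) (p _) T]/(pact rho s p b T).
have -> : \sum_(l < N | (s m < l)%N) mapp (rho s) (pact rho (tperm (s m) l) p [ffun i0 => b (s i0)]) T =
  \sum_(l < N | (s m < s l)%N) pact rho (tperm m l) (pact rho s p) b T.
  rewrite (reindex_inj (@perm_inj _ s)); apply: eq_bigr => l _.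
  rewrite -[LHS]/(pact rho s (pact rho (tperm (s m) (s l)) p) b T) !pactM.
  congr (pact rho _ p b T).
  by rewrite -tpermJ conjgE /s tpermV -!mulgA tperm2 mulg1.
have pp : pact rho (tperm i j) (pact rho s p) = p by rewrite pactM -/s tperm2 pact1.
have ne : i != j by apply/eqP => E; move: ij; rewrite E; lia.
have [mi|mi] := eqVneq m i.
  have -> : \sum_(l < N | (m < l)%N) pact rho (tperm m l) (pact rho s p) b T =
    p b T + \sum_(l < N | (s m < s l)%N) pact rho (tperm m l) (pact rho s p) b T.
    rewrite mi (bigD1 j) /= ?ij // pp; congr (_ + _); apply: eq_bigl => l.
    rewrite /s tpermL -(inj_eq val_inj) /=; case: tpermP => [->|->|/eqP + /eqP];
      rewrite -?(inj_eq val_inj) /=; lia.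
  ring.
have [mj|mj] := eqVneq m j.
  have -> : \sum_(l < N | (s m < s l)%N) pact rho (tperm m l) (pact rho s p) b T =
    p b T + \sum_(l < N | (m < l)%N) pact rho (tperm m l) (pact rho s p) b T.
    rewrite mj (bigD1 i) /= ?tpermL ?tpermR ?ij // tpermC pp; congr (_ + _); apply: eq_bigl => l.
    rewrite /s ?tpermR -(inj_eq val_inj) /=; case: tpermP => [->|->|/eqP + /eqP];
      rewrite -?(inj_eq val_inj) /=; lia.
  ring.
rewrite addr0 addrC; congr (_ * _ + _); apply: eq_bigl => l.
rewrite /s (@tpermD _ i j m) 1?eq_sym //; move: mi mj.
by case: tpermP => [->|->|//]; rewrite -?(inj_eq val_inj) /=; lia.
Qed.

Lemma UopDZ i (x : C) p q :
  Uop k rho i (padd (pscale x p) q) = padd (pscale x (Uop k rho i p)) (Uop k rho i q).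
Proof.
have mulxE r c U : mulx i r c U = (if (0 < c i)%N then r (decr c i) U else 0).
  by rewrite /mulx; case: ifP.
apply: vpoly_ext => b T; rewrite /Uop /Dunkl /padd /pscale.
have -> : \sum_(j < N | j != i) mapp (rho (tperm i j))
    (dd i j (mulx i (fun b T => x * p b T + q b T)) b) T =
  x * \sum_(j < N | j != i) mapp (rho (tperm i j)) (dd i j (mulx i p) b) T +
  \sum_(j < N | j != i) mapp (rho (tperm i j)) (dd i j (mulx i q) b) T.
  rewrite mulr_sumr -big_split /=; apply: eq_bigr => j _.
  rewrite -[RHS]/((fun U => x * mapp _ _ U + mapp _ _ U) T) -mappDZ; congr (mapp _ _ T).
  apply: vec_ext => U; rewrite /dd mulr_sumr -big_split /=; apply: eq_bigr => l _.
  by rewrite !mulxE; case: ifP => _; ring.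
have -> : \sum_(j < N | (j < i)%N) mapp (rho (tperm i j))
    (pvar (tperm i j) (fun b T => x * p b T + q b T) b) T =
  x * \sum_(j < N | (j < i)%N) mapp (rho (tperm i j)) (pvar (tperm i j) p b) T +
  \sum_(j < N | (j < i)%N) mapp (rho (tperm i j)) (pvar (tperm i j) q b) T.
  rewrite mulr_sumr -big_split /=; apply: eq_bigr => j _.
  by rewrite -[RHS]/((fun U => x * mapp _ _ U + mapp _ _ U) T) -mappDZ.
by rewrite /dpart !mulxE ffunE eqxx /=; ring.
Qed.

Lemma pactZ w (x : C) p : pact rho w (pscale x p) = pscale x (pact rho w p).
Proof. by apply: vpoly_ext => b T; rewrite /pact /pvar /pscale mappZ. Qed.

(** The span of p and s_i p is stable under all U_m by the cross relation. The condition on beta is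
    a product, not a quotient, so that it also covers kappa = 0 with x_i = x_j, where beta is still
    the inverse of a content difference. *)
Lemma eigen_swap (i j : 'I_N) (x : 'I_N -> C) (beta : C) p : j = i.+1 :> nat ->
  (forall m, Uop k rho m p = pscale (x m) p) -> beta * (x i - x j) = k ->
  forall m, Uop k rho m (padd (pscale (- beta) p) (pact rho (tperm i j) p)) =
    pscale (x (tperm i j m)) (padd (pscale (- beta) p) (pact rho (tperm i j) p)).
Proof.
move=> ij eig bk m; rewrite UopDZ; apply: vpoly_ext => b T.
rewrite /padd {1 2}/pscale Uop_pact // !eig pactZ /pscale -bk.
have [->|mi] := eqVneq m i; first by rewrite tpermL; ring.
have [->|mj] := eqVneq m j; first by rewrite tpermR; ring.
by rewrite (@tpermD _ i j m) 1?eq_sym //; ring.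
Qed.

Lemma Uop_zero i p b T : k = 0 -> Uop k rho i p b T = ((b i)%:R + 1) * p b T.
Proof.
move=> k0; rewrite /Uop /Dunkl k0 !mul0r subr0 addr0 /dpart /mulx ffunE eqxx /= natr1.
congr (_ * p _ T).
by apply/ffunP => l; rewrite !ffunE; case: eqP => // ->; rewrite eqxx.
Qed.

(** The axioms of the form are restricted to finite support. Homogeneity implies it and is kept by
    the combinations used below. *)
Definition homog n p := forall b, degm b <> n -> p b = vz.

Lemma le_degm b i : (b i <= degm b)%N.
Proof. by rewrite /degm (bigD1 i) //= leq_addr. Qed.

Lemma homog_finsupp n p : homog n p -> finsupp p.
Proof.
move=> hp; exists [seq [ffun i => nat_of_ord (f i)] | f : {ffun 'I_N -> 'I_n.+1}].
move=> b nb; apply: hp => bn; case/negP: nb; apply/imageP.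
exists [ffun i => inord (b i)] => //; apply/ffunP => i.
by rewrite !ffunE inordK // ltnS -bn le_degm.
Qed.

Lemma homogDZ n x p q : homog n p -> homog n q -> homog n (padd (pscale x p) q).
Proof.
by move=> hp hq b bn; apply: vec_ext => T; rewrite /padd /pscale hp // hq // /vzero mulr0 addr0.
Qed.

Lemma homog_pact n w p : homog n p -> homog n (pact rho w p).
Proof.
move=> hp b bn; rewrite /pact /pvar -/(permm b w) hp ?mapp0 //.
by rewrite degm_permm.
Qed.

End Operators.

(** * Joint eigenvectors are determined by their leading coefficient *)

Section Uniqueness.
Variables (C : numClosedFieldType) (N : nat) (sh : seq nat) (k : C).
Hypothesis sh_part : is_partition N sh.
Hypothesis onto : forall T : tab N sh, onto_diag T.
Variable rho : {perm 'I_N} -> vmat C N sh.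
Hypothesis rhoP : is_young_rep rho.
Hypothesis k_small : forall n d : int, n != 0 -> `|d| <= (hook sh)%:Z -> n%:~R + k * d%:~R != 0.
Local Notation vz := (@vzero C N sh).
Implicit Types (p q : vpoly C N sh) (a b c : mono N) (i j : 'I_N) (w : {perm 'I_N}).

Definition spectral a (T : tab N sh) i : C := (a i)%:R + 1 + k * (contz T (rank_perm a i))%:~R.

Lemma spectral_neq a b (T T' : tab N sh) i j : a i != b j -> spectral a T i != spectral b T' j.
Proof.
move=> ab; rewrite -subr_eq0 /spectral.
have -> : (a i)%:R + 1 + k * (contz T (rank_perm a i))%:~R -
    ((b j)%:R + 1 + k * (contz T' (rank_perm b j))%:~R) =
  ((a i)%:Z - (b j)%:Z)%:~R + k * (contz T (rank_perm a i) - contz T' (rank_perm b j))%:~R.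
  by rewrite !intrB -!pmulrn; ring.
apply: k_small; first by lia.
by apply: ltW; apply: contz_bound.
Qed.

(** Conjugation by r_b carries the positions ranked after i to the indices larger than r_b(i). *)
Lemma jucys_murphy_rank b i (v : vec C N sh) :
  mapp (rho (rank_perm b)) (fun T => \sum_(j | precedes b i j) mapp (rho (tperm i j)) v T) =
  jucys_murphy rho (rank_perm b i) (mapp (rho (rank_perm b)) v).
Proof.
rewrite mapp_sum; apply: vec_ext => T; rewrite /jucys_murphy.
rewrite [RHS](reindex_inj (@perm_inj _ (rank_perm b))); apply: eq_big => j.
  by rewrite rank_perm_lt.
move=> _; rewrite -!(mapp_rhoM rhoP); congr (mapp (rho _) v T).
by rewrite -tpermJ conjgE mulKVg.
Qed.

(* At a maximal b in the support of g the eigenvalue equations involve only the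
   Jucys--Murphy elements, and force b = a because |k (c - c')| < 1. *)
Lemma eigen_unique n g a (T : tab N sh) : homog n g ->
  (forall i, Uop k rho i g = pscale (spectral a T i) g) -> g a = vz -> forall b, g b = vz.
Proof.
move=> hg eig ga b.
have [bn|/eqP bn] := eqVneq (degm b) n; last exact: hg.
have wb c : degm c = n -> (wtm c <= N * n)%N.
  move=> <-; rewrite /wtm /degm big_distrr /=; apply: leq_sum => i _.
  by rewrite leq_mul2r leq_subr orbT.
have sb c : degm c = n -> (sqm c <= n * n)%N.
  move=> E; rewrite /sqm -[X in (_ <= X * _)%N]E /degm big_distrl /=; apply: leq_sum => i _.
  by rewrite -mulnn leq_mul2l -E le_degm orbT.
(* In degree n both statistics are bounded, so the lexicographic order is encoded in one number with
   base larger than N n. The induction runs downwards, on the distance of [ms b] from its upper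
   bound. *)
pose ms c := (sqm c * (N * n).+1 + wtm c)%N.
have [m] := ubnP (n * n * (N * n).+1 + N * n - ms b)%N.
elim: m b bn => // m IH b bn /ltnSE le.
have top c : above b c -> g c = vz.
  move=> [cb ab]; have cn : degm c = n by rewrite cb.
  apply: IH => //; apply: leq_trans le.
  have h1 := wb _ bn; have h2 := sb _ bn; have h3 := wb _ cn; have h4 := sb _ cn.
  have lt : (ms b < ms c)%N by rewrite /ms; case: ab => [|[]]; nia.
  have : (ms c <= n * n * (N * n).+1 + N * n)%N by rewrite /ms; nia.
  lia.
have [->//|ba] := eqVneq b a.
have [i abi] : exists i, b i != a i.
  apply/existsP; rewrite -negb_forall; apply: contra ba => /forallP h.
  by apply/eqP/ffunP => i; apply/eqP.
pose v := mapp (rho (rank_perm b)) (g b).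
have E : jucys_murphy rho (rank_perm b i) v =
    mapp (rho (rank_perm b)) (fun U => \sum_(j | precedes b i j) mapp (rho (tperm i j)) (g b) U).
  by rewrite jucys_murphy_rank.
have v0 : v = vz.
  apply: vec_ext => U; apply/eqP; rewrite /vzero.
  have e2 : (fun U => ((b i)%:R + 1 - spectral a T i) * g b U + k * \sum_(j | precedes b i j) mapp (rho (tperm i j)) (g b) U) = vz.
    apply: vec_ext => V; have := Uop_lead k rho i V top; rewrite eig /pscale /vzero => e3.
    by rewrite mulrBl -addrAC -e3 subrr.
  have e4 := congr1 (fun f => mapp (rho (rank_perm b)) f U) e2.
  move: e4; rewrite mappDZ mappZ -E (jucys_murphyE sh_part onto rhoP) -/v mapp0 /vzero => e4.
  have : spectral b U i != spectral a T i by apply: spectral_neq.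
  rewrite -subr_eq0 => /negbTE nz.
  have : (spectral b U i - spectral a T i) * v U == 0 by apply/eqP; rewrite -e4 /spectral; ring.
  by rewrite mulf_eq0 nz.
by rewrite -[g b](mapp_rhoK rhoP (rank_perm b)) -/v v0 mapp0.
Qed.

Variable zeta : mono N -> tab N sh -> vpoly C N sh.
Hypothesis zetaP : forall a T, is_zeta k rho a T (zeta a T).

Lemma contnE (T : tab N sh) a i : contn T (rank a i).-1 = contz T (rank_perm a i).
Proof. by rewrite /contn -rank_permE valK. Qed.

Lemma zeta_homog a T : homog (degm a) (zeta a T).
Proof.
move=> b ba; case: (zetaP a T) => _ h _; apply: h.
  by apply/eqP => E; rewrite E in ba.
by apply/negP => /tri_degm.
Qed.

Lemma zeta_lead a T : zeta a T a = mapp (rho (rank_perm a)^-1%g) (tbasis C T).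
Proof. by case: (zetaP a T) => h _ _; apply: h => i; rewrite rank_permE. Qed.

Lemma zeta_eig a T i : Uop k rho i (zeta a T) = pscale (spectral a T i) (zeta a T).
Proof. by case: (zetaP a T) => _ _ ->; rewrite contnE. Qed.

(** The difference f - [zeta a T] is an eigenvector whose coefficient at a is zero. *)
Lemma eigen_zeta f a T : homog (degm a) f ->
  (forall i, Uop k rho i f = pscale (spectral a T i) f) -> f a = zeta a T a -> f = zeta a T.
Proof.
move=> hf eig fa; have := @eigen_unique (degm a) (padd (pscale (-1) (zeta a T)) f) a T.
move=> h; have {}h : forall b, padd (pscale (-1) (zeta a T)) f b = vz.
  apply: h.
  - by apply: homogDZ => //; apply: zeta_homog.
  - move=> i; rewrite UopDZ eig zeta_eig; apply: vpoly_ext => b U.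
    by rewrite /padd /pscale; ring.
  by apply: vec_ext => U; rewrite /padd /pscale fa mulN1r addNr.
apply: vpoly_ext => b U; have := congr1 (fun v => v U) (h b).
by rewrite /padd /pscale /vzero mulN1r => /eqP; rewrite addrC subr_eq0 => /eqP.
Qed.

(** The right side has the exchanged eigenvalues by [eigen_swap]. At the exponent s_i a the term
    [zeta a T] is absent, because s_i a is not below a, and s_i moves the leading coefficient at a
    to the one required. *)
Lemma zeta_step a T (i j : 'I_N) : j = i.+1 :> nat -> (a i < a j)%N ->
  zeta (permm a (tperm i j)) T =
  padd (pscale (- (k / (spectral a T i - spectral a T j))) (zeta a T)) (pact rho (tperm i j) (zeta a T)).
Proof.
move=> ij aij; have ne : a i != a j by rewrite neq_ltn aij.
have rk := rank_perm_tperm ij ne.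
symmetry; apply: eigen_zeta.
- rewrite degm_permm; apply: homogDZ; first exact: zeta_homog.
  by apply: homog_pact; apply: zeta_homog.
- move=> m; have -> : spectral (permm a (tperm i j)) T m = spectral a T (tperm i j m).
    by rewrite /spectral ffunE rk permM.
  apply: (eigen_swap rhoP (x := spectral a T)) => //; first by move=> l; rewrite zeta_eig.
  by rewrite divfK // subr_eq0 spectral_neq.
apply: vec_ext => U; rewrite zeta_lead rk invMg tpermV (mapp_rhoM rhoP) -zeta_lead.
rewrite /padd /pscale /pact /pvar -/(permm _ _) permm_tpermK.
case: (zetaP a T) => _ h _; rewrite h ?mulr0 ?add0r //; last exact: tri_swap.
apply: contraTneq aij => E; have := congr1 (fun f : mono N => f i) E.
by rewrite ffunE tpermL => ->; rewrite ltnn.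
Qed.

(** Here s_i fixes a, and r_a turns it into the transposition of two adjacent ranks acting on T. A
    content difference of at least 2 selects the case of Young's formula in which T' has coefficient
    1, so the leading coefficients agree. *)
Lemma zeta_step_eq a T T' (i j : 'I_N) : j = i.+1 :> nat -> a i = a j ->
  (2 <= contz T (rank_perm a i) - contz T (rank_perm a j))%R ->
  val T' = [ffun l => val T (tperm (rank_perm a i) (rank_perm a j) l)] ->
  zeta a T' =
  padd (pscale (- ((contz T (rank_perm a i) - contz T (rank_perm a j))%:~R)^-1) (zeta a T))
       (pact rho (tperm i j) (zeta a T)).
Proof.
move=> ij aij b2 TT'; have rk := rank_perm_next ij aij.
set bz := contz T _ - _ in b2 *.
have bz0 : bz%:~R != 0 :> C by rewrite intr_eq0; lia.
symmetry; apply: eigen_zeta.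
- apply: homogDZ; first exact: zeta_homog.
  by apply: homog_pact; apply: zeta_homog.
- move=> m; have -> : spectral a T' m = spectral a T (tperm i j m).
    rewrite /spectral /contz TT' ffunE -(inj_tperm _ _ _ (@perm_inj _ (rank_perm a))).
    by congr (_%:R + 1 + _); case: tpermP => [->|->|].
  apply: (eigen_swap rhoP (x := spectral a T)) => //; first by move=> l; rewrite zeta_eig.
  rewrite /spectral aij.
  have -> : (a j)%:R + 1 + k * (contz T (rank_perm a i))%:~R -
    ((a j)%:R + 1 + k * (contz T (rank_perm a j))%:~R) = k * bz%:~R.
    by rewrite /bz intrB; ring.
  by field.
apply: vec_ext => U; rewrite /padd /pscale /pact /pvar -/(permm _ _) permm_tperm_eq //.
rewrite !zeta_lead -(mapp_rhoM rhoP).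
have -> : ((rank_perm a)^-1 * tperm i j)%g =
    (tperm (rank_perm a i) (rank_perm a j) * (rank_perm a)^-1)%g.
  by rewrite -tpermJ conjgE !mulgA mulgK.
rewrite (mapp_rhoM rhoP).
rewrite -[LHS]/((fun U => - bz%:~R^-1 * mapp (rho (rank_perm a)^-1%g) (tbasis C T) U +
   mapp (rho (rank_perm a)^-1%g) (mapp (rho (tperm (rank_perm a i) (rank_perm a j))) (tbasis C T)) U) U).
rewrite -mappDZ; congr (mapp _ _ U); apply: vec_ext => V.
rewrite mapp_tbasis; case: rhoP => _ _ -> //; rewrite /Ms -/bz -TT' (inj_eq val_inj) b2 /tbasis.
by case: (V == T); case: (V == T'); rewrite /= ?mulr1n ?mulr0n; ring.
Qed.

End Uniqueness.

(** * Orthogonality and norm ratios for the form on the torus *)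

Section Form.
Variables (C : numClosedFieldType) (N : nat) (sh : seq nat) (k : C).
Hypothesis sh_part : is_partition N sh.
Hypothesis onto : forall T : tab N sh, onto_diag T.
Variable rho : {perm 'I_N} -> vmat C N sh.
Hypothesis rhoP : is_young_rep rho.
Hypothesis k_small : forall n d : int, n != 0 -> `|d| <= (hook sh)%:Z -> n%:~R + k * d%:~R != 0.
Hypothesis k_real : Num.conj k = k.
Variable H : vpoly C N sh -> vpoly C N sh -> C.
Hypothesis HP : is_form k rho H.
Local Notation vz := (@vzero C N sh).
Implicit Types (p q f g : vpoly C N sh) (a b c : mono N) (i j : 'I_N) (w : {perm 'I_N}).

Definition pzero : vpoly C N sh := fun _ => vz.

Lemma form_sym n f g : homog n f -> homog n g -> H g f = Num.conj (H f g).
Proof. by case: HP => _ h _ _ hf hg; apply: h; apply: homog_finsupp; eassumption. Qed.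

Lemma formDZ n x f g h : homog n f -> homog n g -> homog n h ->
  H f (padd (pscale x g) h) = x * H f g + H f h.
Proof. by case: HP => H1 _ _ _ hf hg hh; apply: H1; apply: homog_finsupp; eassumption. Qed.

Lemma form0 n f : homog n f -> H f pzero = 0.
Proof.
move=> hf; have E : padd (pscale (-1) pzero) pzero = pzero.
  by apply: vpoly_ext => b T; rewrite /padd /pscale /pzero /vzero mulr0 addr0.
by rewrite -{1}E (formDZ _ hf) // mulN1r addNr.
Qed.

Lemma formZ n x f g : homog n f -> homog n g -> H f (pscale x g) = x * H f g.
Proof.
move=> hf hg; have E : padd (pscale x g) pzero = pscale x g.
  by apply: vpoly_ext => b T; rewrite /padd /pzero /vzero addr0.
by rewrite -E (formDZ _ hf) // (form0 hf) addr0.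
Qed.

Lemma homog_sum n (I : Type) (s : seq I) (P : pred I) (x : I -> C) (g : I -> vpoly C N sh) :
  (forall e, homog n (g e)) -> homog n (fun b T => \sum_(e <- s | P e) x e * g e b T).
Proof.
move=> hg b bn; apply: vec_ext => T; rewrite big1 // => e _.
by rewrite hg // /vzero mulr0.
Qed.

Lemma form_sumr n (I : Type) (s : seq I) (P : pred I) (x : I -> C) (g : I -> vpoly C N sh) f :
  homog n f -> (forall e, homog n (g e)) ->
  H f (fun b T => \sum_(e <- s | P e) x e * g e b T) = \sum_(e <- s | P e) x e * H f (g e).
Proof.
move=> hf hg; elim: s => [|e s IH].
  rewrite big_nil -[RHS](form0 hf); congr (H f).
  by apply: vpoly_ext => b T; rewrite big_nil.
rewrite big_cons; case: (boolP (P e)) => Pe.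
  rewrite -IH -(formDZ _ hf) //; last exact: homog_sum.
  by congr (H f); apply: vpoly_ext => b T; rewrite big_cons Pe.
rewrite -IH; congr (H f); apply: vpoly_ext => b T.
by rewrite big_cons (negbTE Pe).
Qed.

Lemma form_suml n (I : Type) (s : seq I) (P : pred I) (x : I -> C) (g : I -> vpoly C N sh) f :
  homog n f -> (forall e, homog n (g e)) ->
  H (fun b T => \sum_(e <- s | P e) x e * g e b T) f =
  \sum_(e <- s | P e) Num.conj (x e) * H (g e) f.
Proof.
move=> hf hg; rewrite (form_sym hf); last exact: homog_sum.
rewrite (form_sumr _ _ _ hf hg) rmorph_sum /=; apply: eq_bigr => e _.
by rewrite rmorphM /= -(form_sym hf).
Qed.

Lemma form_pact n w f g : homog n f -> homog n g -> H (pact rho w f) (pact rho w g) = H f g.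
Proof. by case: HP => _ _ _ [h _] hf hg; apply: h; apply: homog_finsupp; eassumption. Qed.

Lemma pact_tpermK i j f : pact rho (tperm i j) (pact rho (tperm i j) f) = f.
Proof. by rewrite (pactM rhoP) tperm2 (pact1 rhoP). Qed.

Lemma form_tperm n i j f g : homog n f -> homog n g ->
  H (pact rho (tperm i j) f) g = H f (pact rho (tperm i j) g).
Proof.
move=> hf hg; rewrite -(@form_pact n (tperm i j)) ?pact_tpermK //.
exact: homog_pact.
Qed.

(** U_i is self-adjoint: for real kappa both x_i D_i and the sum of transpositions in [UopE] are.
    Since the axiom concerns x_i D_i, the eigenvalue equations are first solved for it. *)
Lemma eigen_orth n i f g (x y : C) : homog n f -> homog n g ->
  Num.conj x = x -> x != y ->
  Uop k rho i f = pscale x f -> Uop k rho i g = pscale y g -> H f g = 0.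
Proof.
move=> hf hg xr xy Uf Ug.
have xD h (z : C) : Uop k rho i h = pscale z h -> mulx i (Dunkl k rho i h) =
    padd (pscale (- k) (fun b T => \sum_(j <- index_enum 'I_N | (i < j)%N) 1 * pact rho (tperm i j) h b T))
      (pscale (z - 1) h).
  move=> Uh; apply: vpoly_ext => b T; rewrite /padd /pscale.
  have := UopE k rho i h b T; rewrite Uh /pscale => E.
  have -> : \sum_(j <- index_enum 'I_N | (i < j)%N) 1 * pact rho (tperm i j) h b T =
    \sum_(j < N | (i < j)%N) pact rho (tperm i j) h b T.
    by apply: eq_bigr => j _; rewrite mul1r.
  by rewrite mulrBl E; ring.
have hP h (z : C) : homog n h -> homog n (pscale z h).
  by move=> hh b bn; apply: vec_ext => T; rewrite /pscale hh // /vzero mulr0.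
have HxD h h' (z : C) : homog n h -> homog n h' -> Uop k rho i h = pscale z h ->
   H h' (mulx i (Dunkl k rho i h)) =
   - k * (\sum_(j < N | (i < j)%N) H h' (pact rho (tperm i j) h)) + (z - 1) * H h' h.
  move=> hh hh' Uh; rewrite (xD _ _ Uh) (formDZ _ hh'); last exact: hP.
    rewrite (formZ _ hh') // (form_sumr _ _ _ hh') => [|j]; last exact: homog_pact.
    by congr (_ * _ + _); apply: eq_bigr => j _; rewrite mul1r.
  by apply: homog_sum => j; apply: homog_pact.
have hxD h (z : C) : homog n h -> Uop k rho i h = pscale z h -> homog n (mulx i (Dunkl k rho i h)).
  move=> hh Uh; rewrite (xD _ _ Uh); apply: homogDZ; last exact: hP.
  by apply: homog_sum => j; apply: homog_pact.
have E : H (mulx i (Dunkl k rho i f)) g = H f (mulx i (Dunkl k rho i g)).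
  by case: HP => _ _ _ [_ [h _]]; apply: h; apply: homog_finsupp; eassumption.
move: E; rewrite (form_sym hg (hxD _ _ hf Uf)) (HxD _ _ _ hf hg Uf) (HxD _ _ _ hg hf Ug).
rewrite rmorphD !rmorphM rmorphN rmorphB /= k_real rmorph1 xr -(form_sym hg hf) rmorph_sum /=.
have -> : \sum_(j < N | (i < j)%N) Num.conj (H g (pact rho (tperm i j) f)) =
  \sum_(j < N | (i < j)%N) H f (pact rho (tperm i j) g).
  apply: eq_bigr => j _; rewrite -(form_sym hg) ?(form_tperm _ _ hf hg) //.
  exact: homog_pact.
move=> /addrI /eqP; rewrite -subr_eq0 -mulrBl mulf_eq0 => /orP[|/eqP //].
rewrite opprB addrA subrK subr_eq0 => /eqP E.
by rewrite E eqxx in xy.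
Qed.

(** Pythagoras: s f has the norm of f, and orthogonality says that beta f is its projection onto
    f. *)
Lemma norm_swap n i j f (beta : C) : homog n f -> Num.conj beta = beta ->
  H f (padd (pscale (- beta) f) (pact rho (tperm i j) f)) = 0 ->
  H (padd (pscale (- beta) f) (pact rho (tperm i j) f))
    (padd (pscale (- beta) f) (pact rho (tperm i j) f)) = (1 - beta ^+ 2) * H f f.
Proof.
move=> hf br; have hs : homog n (pact rho (tperm i j) f) by apply: homog_pact.
set g := padd _ _; have hg : homog n g by apply: homogDZ.
move=> E0; have gf : H g f = 0 by rewrite (form_sym hf hg) E0 rmorph0.
rewrite {2}/g (formDZ _ hg) // gf mulr0 add0r.
rewrite (form_sym hs hg) {1}/g (formDZ _ hs) // (@form_pact n) //.
have : H f g = - beta * H f f + H f (pact rho (tperm i j) f) by rewrite /g (formDZ _ hf).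
rewrite E0 => /eqP; rewrite eq_sym addrC mulNr subr_eq0 => /eqP E1.
rewrite (form_tperm _ _ hf hf) E1 !(rmorphD, rmorphM, rmorphN) /= br -(form_sym hf hf); ring.
Qed.

Definition vmon a (v : vec C N sh) : vpoly C N sh := fun b => if b == a then v else vz.

Lemma vmon_homog a v : homog (degm a) (vmon a v).
Proof. by move=> b ba; rewrite /vmon; case: eqP => // E; rewrite E in ba. Qed.

(** Multiplication by x_i is an isometry, so the variables of x^a are stripped from both arguments
    one at a time. *)
Lemma form_vmon a (u v : vec C N sh) : H (vmon a u) (vmon a v) = H (vmon (mono0 N) u) (vmon (mono0 N) v).
Proof.
have [n] := ubnP (degm a); elim: n a => // n IH a /ltnSE an.
have [->//|a0] := eqVneq a (mono0 N).
have [i ai] : exists i, (0 < a i)%N.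
  apply/existsP; rewrite -[[exists _, _]]negbK negb_exists; apply: contra a0 => /forallP h.
  by apply/eqP/ffunP => i; rewrite ffunE; apply/eqP; rewrite -leqn0 leqNgt; apply: h.
have mE v' : vmon a v' = mulx i (vmon (decr a i) v').
  apply: functional_extensionality => b; rewrite /vmon /mulx -/(decr b i).
  have [->|ba] := eqVneq b a; first by rewrite ai eqxx.
  case: ifP => // bi; case: eqP => // /ffunP E; case/eqP: ba; apply/ffunP => l.
  have := E l; rewrite !ffunE; case: eqP => // -> e.
  by rewrite -(prednK ai) -(prednK bi) e.
have lt : (degm (decr a i) < degm a)%N.
  rewrite /degm (bigD1 i) // [X in (_ < X)%N](bigD1 i) //= ffunE eqxx.
  rewrite (eq_bigr (fun l => a l)); first by rewrite ltn_add2r prednK.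
  by move=> l /negbTE li; rewrite ffunE li.
rewrite !mE -(IH (decr a i)); last exact: leq_trans lt an.
by case: HP => _ _ _ [_ [_ h]]; apply: h; apply: homog_finsupp; apply: vmon_homog.
Qed.

Variable zeta : mono N -> tab N sh -> vpoly C N sh.
Hypothesis zetaP : forall a T, is_zeta k rho a T (zeta a T).

Lemma spectral_real a (T : tab N sh) i : Num.conj (spectral k a T i) = spectral k a T i.
Proof. by rewrite /spectral !(rmorphD, rmorphM, rmorph_nat, rmorph1, rmorph_int) /= k_real. Qed.

(* For k = 0 the spectral vectors do not separate the tableaux; then zeta a T is
   supported on the single monomial a, and the form reduces to the one on V_tau. *)
Lemma zeta_orth a a' (T T' : tab N sh) : degm a = degm a' ->
  a != a' \/ a = a' /\ T != T' /\ (k != 0 -> exists i, contz T i != contz T' i) ->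
  H (zeta a T) (zeta a' T') = 0.
Proof.
move=> deg; have h1 := zeta_homog zetaP (a := a) T.
have h2 := zeta_homog zetaP (a := a') T'.
rewrite -deg in h2.
have main i : spectral k a T i != spectral k a' T' i -> H (zeta a T) (zeta a' T') = 0.
  move=> ne; apply: (eigen_orth h1 h2 (spectral_real a T i) ne); exact: zeta_eig.
case=> [ne|[E [ne diff]]].
  have [i ai] : exists i, a i != a' i.
    apply/existsP; rewrite -negb_forall; apply: contra ne => /forallP h.
    by apply/eqP/ffunP => i; apply/eqP.
  by apply: (main i); apply: (spectral_neq sh_part k_small).
rewrite -{}E in h2 main *; have [k0|k0] := eqVneq k 0; last first.
  have [i ci] := diff k0; apply: (main ((rank_perm a)^-1%g i)).
  rewrite /spectral permKV -subr_eq0 opprD addrACA subrr add0r -mulrBr -intrB mulf_eq0.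
  by rewrite (negbTE k0) intr_eq0 subr_eq0.
have zE U : zeta a U = vmon a (mapp (rho (rank_perm a)^-1%g) (tbasis C U)).
  apply: vpoly_ext => b V; rewrite /vmon; case: eqP => [->|/eqP ba].
    by rewrite (zeta_lead zetaP).
  have [i bi] : exists i, b i != a i.
    apply/existsP; rewrite -negb_forall; apply: contra ba => /forallP h.
    by apply/eqP/ffunP => i; apply/eqP.
  have := Uop_zero rho i (zeta a U) b V k0; rewrite (zeta_eig zetaP) /pscale /spectral.
  rewrite {1}k0 mul0r addr0 => /eqP; rewrite -subr_eq0 -mulrBl mulf_eq0 => /orP[|/eqP //].
  by rewrite opprD addrACA subrr addr0 subr_eq0 eqr_nat eq_sym (negbTE bi).
have vE (w : {perm 'I_N}) U : vmon (mono0 N) (mapp (rho w) (tbasis C U)) = pact rho w (pone C U).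
  apply: vpoly_ext => b V; rewrite /vmon /pact /pvar /pone.
  have -> : ([ffun i => b (w i)] == mono0 N) = (b == mono0 N).
    apply/eqP/eqP => [/ffunP E|->]; apply/ffunP => i; last by rewrite !ffunE.
    by have := E (w^-1%g i); rewrite !ffunE permKV.
  by case: ifP => //; rewrite mapp0.
have h0 U : homog (degm (mono0 N)) (pone C U : vpoly C N sh) by apply: vmon_homog.
rewrite !zE form_vmon !vE (form_pact _ (h0 _) (h0 _)).
by case: HP => _ _ -> _; rewrite /ip0 (negbTE ne).
Qed.

Lemma zeta_norm_step a (T : tab N sh) (i j : 'I_N) : j = i.+1 :> nat -> (a i < a j)%N ->
  H (zeta (permm a (tperm i j)) T) (zeta (permm a (tperm i j)) T) =
  (1 - (k / (spectral k a T i - spectral k a T j)) ^+ 2) * H (zeta a T) (zeta a T).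
Proof.
move=> ij aij; have st := zeta_step sh_part onto rhoP k_small zetaP T ij aij.
rewrite st; apply: (@norm_swap (degm a)).
- exact: zeta_homog.
- by rewrite rmorphM fmorphV rmorphB /= !spectral_real k_real.
rewrite -st; apply: zeta_orth; first by rewrite degm_permm.
left; apply: contraTneq aij => E; have := congr1 (fun f : mono N => f i) E.
by rewrite ffunE tpermL => ->; rewrite ltnn.
Qed.

Lemma zeta_norm_step_eq a (T T' : tab N sh) (i j : 'I_N) : j = i.+1 :> nat -> a i = a j ->
  (2 <= contz T (rank_perm a i) - contz T (rank_perm a j))%R ->
  val T' = [ffun l => val T (tperm (rank_perm a i) (rank_perm a j) l)] ->
  H (zeta a T') (zeta a T') =
  (1 - ((contz T (rank_perm a i) - contz T (rank_perm a j))%:~R)^-1 ^+ 2) * H (zeta a T) (zeta a T).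
Proof.
move=> ij aij b2 TT'; have st := zeta_step_eq sh_part onto rhoP k_small zetaP ij aij b2 TT'.
rewrite st; apply: (@norm_swap (degm a)).
- exact: zeta_homog.
- by rewrite fmorphV rmorph_int.
rewrite -st; apply: zeta_orth => //; right; split=> //.
have ne : contz T (rank_perm a i) != contz T' (rank_perm a i).
  by rewrite [contz T' _]/contz TT' ffunE tpermL -/(contz _ _); lia.
split; last by move=> _; exists (rank_perm a i).
by apply: contraNneq ne => ->.
Qed.

End Form.

(** * The tableaux T_R and T_S and their order on equal entries *)

Section Numberings.
Variables (N : nat) (sh : seq nat) (lam : mono N).
Hypothesis sh_part : is_partition N sh.
Hypothesis onto : forall T : tab N sh, onto_diag T.
Hypothesis lam_sorted : forall i j : 'I_N, (i <= j)%N -> (lam j <= lam i)%N.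
Implicit Types (T : tab N sh).

Lemma fillE a T p : fill a T (val T p) = nth 0%N (plusm a) p.
Proof.
rewrite /fill; case: pickP => [q /eqP /(@tab_inj _ _ T) -> //|/(_ p)].
by rewrite eqxx.
Qed.

Lemma fill_lam T p : fill lam T (val T p) = lam p.
Proof. by rewrite fillE -[in RHS](nth_plusm lam p) rank_perm_sorted // perm1. Qed.

Lemma card_cells T (P : pred 'I_N) (Q : pred ('I_N * 'I_N)) :
  (forall p, Q (val T p) = P p) ->
  #|[pred d | in_diag sh d && Q d]| = #|P|.
Proof.
move=> QP; rewrite -(card_imset P (@tab_inj _ _ T)); apply: eq_card => d.
rewrite !inE; apply/andP/imsetP => [[dd qd]|[p pP ->]]; last first.
  by rewrite tab_diag QP.
by have [p E] := onto T dd; exists p; rewrite // unfold_in -QP E.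
Qed.

(** The number of c exceeds the count of larger entries by at least 1 and at most the number of
    cells tied with c, and the sorted lambda is constant on these indices. The tie rule stays
    abstract to serve T_R and T_S alike. *)
Lemma fill_of_number T T' (num : 'I_N * 'I_N -> nat) (tie : 'I_N * 'I_N -> rel ('I_N * 'I_N)) :
  (forall c, num c = (#|[pred d | in_diag sh d && (fill lam T c < fill lam T d)%N]| +
     #|[pred d | [&& in_diag sh d, fill lam T d == fill lam T c & tie c d c]]|)%N) ->
  (forall c, tie c c c) -> is_numbered num T' -> fill lam T' =1 fill lam T.
Proof.
move=> numE tie0 nT' c; case: (boolP (in_diag sh c)) => cd; last first.
  rewrite /fill; case: pickP => [p /eqP E|_]; first by rewrite -E tab_diag in cd.
  by case: pickP => [p /eqP E|//]; rewrite -E tab_diag in cd.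
have [p [pn Ec]] := nT' _ cd; have [m Em] := onto T cd.
rewrite -{1}Ec -Em !fill_lam.
set A := #|[pred d | in_diag sh d && (fill lam T c < fill lam T d)%N]|.
have AE : A = #|[pred x : 'I_N | (lam m < lam x)%N]|.
  apply: (@card_cells T [pred x | (lam m < lam x)%N] (fun d => fill lam T c < fill lam T d)%N).
  by move=> x /=; rewrite -Em !fill_lam.
set E := #|[pred d | [&& in_diag sh d, fill lam T d == fill lam T c & tie c d c]]|.
have E1 : (0 < E)%N by apply/card_gt0P; exists c; rewrite inE cd eqxx tie0.
have E2 : (E <= #|[pred x : 'I_N | lam x == lam m]|)%N.
  rewrite -(@card_cells T [pred x : 'I_N | lam x == lam m] (fun d => fill lam T d == fill lam T c)).
    by apply: subset_leq_card; apply/subsetP => d; rewrite !inE => /and3P[-> -> _].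
  by move=> x /=; rewrite -Em !fill_lam.
(* Numbers of cells start at 1, indices at 0. *)
have pE : nat_of_ord p = (A + E).-1 by rewrite -[nat_of_ord p]/(val p) pn numE.
have sub1 : (#|[pred x : 'I_N | (lam m < lam x)%N]| + #|[pred x : 'I_N | lam x == lam m]| =
   #|[pred x : 'I_N | (lam m <= lam x)%N]|)%N.
  rewrite -cardUI [X in (_ + X)%N]eq_card0 ?addn0; last by move=> x; rewrite !inE /=; lia.
  by apply: eq_card => x; rewrite !inE; lia.
apply/eqP; rewrite eqn_leq; apply/andP; split; rewrite leqNgt; apply/negP => lt.
  have : (p.+1 <= #|[pred x : 'I_N | (lam m < lam x)%N]|)%N.
    rewrite -(@card_ord_lt N p.+1 (ltn_ord p)); apply: subset_leq_card.
    by apply/subsetP => x; rewrite !inE ltnS => /lam_sorted; lia.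
  by lia.
have : (#|[pred x : 'I_N | (lam m <= lam x)%N]| <= p)%N.
  rewrite -[X in (_ <= X)%N](@card_ord_lt N p (ltnW (ltn_ord p))); apply: subset_leq_card.
  apply/subsetP => x; rewrite !inE => h; rewrite ltnNge; apply/negP => /lam_sorted; lia.
by lia.
Qed.

Lemma fill_TS T (TS : tab N sh) : is_numbered (TSnum sh (fill lam T)) TS -> fill lam TS = fill lam T.
Proof.
move=> h; apply: functional_extensionality.
apply: (@fill_of_number T TS _ (fun c d _ => (c.1 < d.1)%N || ((d.1 == c.1) && (c.2 <= d.2)%N)) _ _ h) => [c|c] //.
by rewrite ltnn eqxx leqnn.
Qed.

Lemma fill_TR T (TR : tab N sh) : is_numbered (TRnum sh (fill lam T)) TR -> fill lam TR = fill lam T.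
Proof.
move=> h; apply: functional_extensionality.
apply: (@fill_of_number T TR _ (fun c d _ => (c.2 < d.2)%N || ((d.2 == c.2) && (c.1 <= d.1)%N)) _ _ h) => [c|c] //.
by rewrite ltnn eqxx leqnn.
Qed.

Lemma numbered_lt T (num : 'I_N * 'I_N -> nat) (p q : 'I_N) : is_numbered num T -> (p < q)%N ->
  (num (val T p) < num (val T q))%N.
Proof.
move=> nT; have [p' [E1 /(@tab_inj _ _ T) E2]] := nT _ (tab_diag T p).
have [q' [E3 /(@tab_inj _ _ T) E4]] := nT _ (tab_diag T q).
move: E1 E3; rewrite {}E2 {}E4 /=; lia.
Qed.

Variable TS : tab N sh.
Hypothesis cF : colstrict sh (fill lam TS).
Hypothesis TS_num : is_numbered (TSnum sh (fill lam TS)) TS.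

(** Among equal entries T_S numbers the rows from the bottom up and each row from right to left. In
    any other order the cells counted for q would all be counted for p. *)
Lemma TS_order (p q : 'I_N) : (p < q)%N -> lam p = lam q ->
  ((val TS q).1 < (val TS p).1)%N || ((val TS p).1 == (val TS q).1) && ((val TS q).2 < (val TS p).2)%N.
Proof.
move=> pq E; rewrite -[_ || _]negbK; apply/negP => h.
have := numbered_lt TS_num pq; rewrite ltnNge => /negP; apply.
rewrite /TSnum !fill_lam E leq_add2l; apply: subset_leq_card; apply/subsetP => d.
rewrite !inE => /and3P[-> -> /=]; move: h; rewrite -!(inj_eq val_inj) /=; lia.
Qed.

Lemma seg_same (p q : 'I_N) : (p < q)%N -> lam p = lam q -> (val TS p).1 = (val TS q).1 ->
  ((val TS q).2 < (val TS p).2)%N.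
Proof. by move=> pq E r; have := TS_order pq E; rewrite r ltnn eqxx. Qed.

(** p lies strictly below q and, by the strip property, strictly to its left. Row and column each
    add at least 1 to the content gap. *)
Lemma seg_diff (p q : 'I_N) : (p < q)%N -> lam p = lam q -> (val TS p).1 != (val TS q).1 ->
  (contz TS p <= contz TS q - 2)%R.
Proof.
move=> pq E /negbTE r; have := TS_order pq E; rewrite r orbF => lt.
have := @colstrict_strip _ _ sh_part (fill lam TS) (val TS q) (val TS p) cF (tab_diag TS p) _ lt.
rewrite !fill_lam E => /(_ erefl); rewrite /contz; lia.
Qed.

(** T_R numbers equal entries column by column from the right. In a strip each column has at most
    one of them, and a move to the left never goes up, so contents fall. *)
Lemma TR_order (TR : tab N sh) (p q : 'I_N) : is_numbered (TRnum sh (fill lam TS)) TR ->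
  fill lam TR = fill lam TS -> (p < q)%N -> lam p = lam q -> (contz TR q < contz TR p)%R.
Proof.
move=> nR fR pq E; have lt := numbered_lt nR pq.
have Fp : fill lam TS (val TR p) = lam p by rewrite -fR fill_lam.
have Fq : fill lam TS (val TR q) = lam q by rewrite -fR fill_lam.
have col : ((val TR q).2 < (val TR p).2)%N || ((val TR p).2 == (val TR q).2) && ((val TR q).1 < (val TR p).1)%N.
  rewrite -[_ || _]negbK; apply/negP => h.
  move: lt; rewrite ltnNge => /negP; apply.
  rewrite /TRnum Fp Fq E leq_add2l; apply: subset_leq_card; apply/subsetP => d.
  rewrite !inE => /and3P[-> -> /=]; move: h; rewrite -!(inj_eq val_inj) /=; lia.
have strip c d := @colstrict_strip _ _ sh_part (fill lam TS) c d cF.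
have s1 := strip (val TR q) (val TR p) (tab_diag TR p) _; rewrite Fp Fq E in s1.
have {}s1 := s1 erefl.
case/orP: col => [h|/andP[/eqP h1 /s1]]; last by rewrite h1 ltnn.
have : ((val TR p).1 <= (val TR q).1)%N by rewrite leqNgt; apply/negP => /s1; lia.
rewrite /contz; lia.
Qed.

End Numberings.

(** * Products over pairs of letters and inversions *)

Section PairProducts.
Variables (C : comNzRingType) (N : nat).

(** q is listed before p in the word s. Inversions are indexed by letters, not positions, because
    the factors belong to pairs of cells. *)
Definition inverted (s : {perm 'I_N}) (p q : 'I_N) := (s^-1%g q < s^-1%g p)%N.

Definition pprod (G : 'I_N -> 'I_N -> C) : C := \prod_(p < N) \prod_(q < N | (p < q)%N) G p q.

Lemma pprodE G : pprod G = \prod_(x : 'I_N * 'I_N | (x.1 < x.2)%N) G x.1 x.2.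
Proof. by rewrite /pprod pair_big_dep. Qed.

Lemma eq_pprod (G G' : 'I_N -> 'I_N -> C) : (forall p q : 'I_N, (p < q)%N -> G p q = G' p q) -> pprod G = pprod G'.
Proof. by move=> E; rewrite !pprodE; apply: eq_bigr => x; apply: E. Qed.

Lemma pprodM (G G' : 'I_N -> 'I_N -> C) : pprod G * pprod G' = pprod (fun p q => G p q * G' p q).
Proof. by rewrite !pprodE big_split. Qed.

Lemma pprod_if (P : 'I_N -> 'I_N -> bool) G :
  \prod_(p < N) \prod_(q < N | (p < q)%N && P p q) G p q = pprod (fun p q => if P p q then G p q else 1).
Proof. by apply: eq_bigr => p _; rewrite big_mkcondr. Qed.

(** Every unordered pair of letters occurs once on each side; on the left it is oriented by its
    order in the word. *)
Lemma pprod_perm (s : {perm 'I_N}) (G : 'I_N -> 'I_N -> C) :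
  pprod (fun i j => G (s i) (s j)) = pprod (fun p q => if inverted s p q then G q p else G p q).
Proof.
rewrite !pprodE.
have sI : injective (fun x : 'I_N * 'I_N => (s^-1%g x.1, s^-1%g x.2)).
  by move=> [a b] [c d] [/perm_inj -> /perm_inj ->].
have swI : injective (fun x : 'I_N * 'I_N => (x.2, x.1)) by move=> [a b] [c d] [-> ->].
rewrite (reindex_inj sI) /= (bigID (fun x : 'I_N * 'I_N => (x.1 < x.2)%N)) /=.
rewrite [RHS](bigID (fun x : 'I_N * 'I_N => inverted s x.1 x.2)) /= mulrC; congr (_ * _).
  rewrite (reindex_inj swI) /=; apply: eq_big => [x|x /andP[h1 h2]].
    rewrite /inverted; case: (ltngtP x.1 x.2) => h; rewrite ?andbF ?andbT //.
    by rewrite (ord_inj h) ltnn.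
  rewrite !permKV; case: ifP => //; move: h1 h2; rewrite /inverted => ->.
  by [].
apply: eq_big => [x|x /andP[h1 h2]].
  rewrite /inverted andbC; case: (boolP (x.1 < x.2)%N) => //= h.
  have : s^-1%g x.1 <> s^-1%g x.2 :> nat.
    by move=> /ord_inj /perm_inj E; rewrite E ltnn in h.
  lia.
by rewrite !permKV /inverted; case: ifP => //; lia.
Qed.

End PairProducts.

Lemma pprod_neq0 (C : fieldType) N (G : 'I_N -> 'I_N -> C) :
  (forall p q : 'I_N, (p < q)%N -> G p q != 0) -> pprod G != 0.
Proof. by move=> h; apply/prodf_neq0 => p _; apply/prodf_neq0 => q; apply: h. Qed.

Lemma pprodV (C : fieldType) N (G : 'I_N -> 'I_N -> C) :
  (pprod G)^-1 = pprod (fun p q => (G p q)^-1).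
Proof. by rewrite !pprodE prodfV. Qed.

Lemma perm_descent N (s : {perm 'I_N}) : s != 1%g ->
  exists i j : 'I_N, j = i.+1 :> nat /\ (s j < s i)%N.
Proof.
move=> s1; case: (boolP [exists i : 'I_N, exists j : 'I_N, (j == i.+1 :> nat) && (s j < s i)%N]).
  by move=> /existsP[i /existsP[j /andP[/eqP ij lt]]]; exists i, j.
move=> none; case/eqP: s1.
have nxt (i j : 'I_N) : j = i.+1 :> nat -> (s i < s j)%N.
  move=> ij; rewrite ltnNge leq_eqVlt; apply/norP; split; last first.
    move: none; rewrite negb_exists => /forallP /(_ i); rewrite negb_exists => /forallP /(_ j).
    by rewrite ij eqxx.
  by apply/eqP => /ord_inj /perm_inj E; move: ij; rewrite E; lia.
have mono_s (i j : 'I_N) : (i < j)%N -> (s i < s j)%N.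
  have [n] := ubnP (nat_of_ord j); elim: n j => // n IH j /ltnSE jn ij.
  have pN : (j.-1 < N)%N by have := ltn_ord j; lia.
  have st := nxt (Ordinal pN) j ltac:(rewrite /=; lia).
  have [E|ne] := eqVneq i (Ordinal pN); first by rewrite E.
  apply: ltn_trans st; apply: IH => /=; first lia.
  have : nat_of_ord i <> j.-1 by move=> E; case/eqP: ne; apply: ord_inj.
  lia.
apply: perm_ord_eq => x y; rewrite !perm1.
case: (ltngtP x y) => [/mono_s|/mono_s|/ord_inj ->]; last by rewrite ltnn.
  by move=> ->.
lia.
Qed.

(** * The factors of C_epsilon, for any two indices *)

Section ContentFactors.
Variables (C : numClosedFieldType) (N : nat) (sh : seq nat) (TS : tab N sh).

Definition content_factor (e : C) p q : C := if (contz TS p <= contz TS q - 2)%R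
  then 1 + e / (contz TS p - contz TS q)%:~R else 1.

Lemma Ceps_base (e : C) : Ceps e TS = pprod (content_factor e).
Proof. by rewrite /Ceps pprod_if. Qed.

Lemma content_factor_neq0 (e : C) p q : e = 1 \/ e = -1 -> content_factor e p q != 0.
Proof.
move=> he; rewrite /content_factor; case: ifP => h; last exact: oner_neq0.
set d := contz TS p - contz TS q; have d0 : d%:~R != 0 :> C by rewrite intr_eq0; lia.
have -> : 1 + e / d%:~R = (d%:~R + e) / d%:~R by field.
rewrite mulf_neq0 ?invr_neq0 //; case: he => ->.
  by rewrite -[1]/(1%:~R) -intrD intr_eq0; lia.
by rewrite -[-1]/((-1)%:~R) -intrD intr_eq0; lia.
Qed.

End ContentFactors.

(** * The coefficients b and the words that encode T(lambda, T_S) *)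

Section Words.
Variables (C : numClosedFieldType) (N : nat) (sh : seq nat) (k : C).
Hypothesis sh_part : is_partition N sh.
Hypothesis onto : forall T : tab N sh, onto_diag T.
Hypothesis k_small : forall n d : int, n != 0 -> `|d| <= (hook sh)%:Z -> n%:~R + k * d%:~R != 0.
Variable lam : mono N.
Hypothesis lam_sorted : forall i j : 'I_N, (i <= j)%N -> (lam j <= lam i)%N.
Variable TS : tab N sh.
Hypothesis cF : colstrict sh (fill lam TS).
Hypothesis TS_num : is_numbered (TSnum sh (fill lam TS)) TS.
Implicit Types (p q : 'I_N) (s : {perm 'I_N}).

Definition same_seg p q := (lam p == lam q) && ((val TS p).1 == (val TS q).1).

(* [k / (xi_p - xi_q)] for the cells p, q; when their entries agree k is cancelled,
   which gives the right value at k = 0 as well. *)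
Definition swap_coef p q : C := if lam p == lam q then ((contz TS p - contz TS q)%:~R)^-1
  else k / ((lam p)%:R - (lam q)%:R + k * (contz TS p - contz TS q)%:~R).

Lemma swap_coefN p q : swap_coef q p = - swap_coef p q.
Proof.
rewrite /swap_coef eq_sym; case: eqP => _.
  by rewrite -(opprB (contz TS p)) rmorphN invrN.
have -> : (lam q)%:R - (lam p)%:R + k * (contz TS q - contz TS p)%:~R =
  - ((lam p)%:R - (lam q)%:R + k * (contz TS p - contz TS q)%:~R) :> C.
  by rewrite !intrB; ring.
by rewrite invrN mulrN.
Qed.

Lemma contz_seg p q : p != q -> lam p = lam q -> contz TS p != contz TS q.
Proof.
wlog lt : p q / (p < q)%N => [W|] pq E.
  case: (ltngtP p q) => [h|h|/ord_inj h]; first exact: W.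
    by rewrite eq_sym; apply: W; rewrite // eq_sym.
  by rewrite h eqxx in pq.
have [r|r] := eqVneq (val TS p).1 (val TS q).1.
  by have := seg_same sh_part lam_sorted TS_num lt E r; rewrite /contz r; lia.
by have := seg_diff sh_part lam_sorted cF TS_num lt E r; lia.
Qed.

Lemma denom_neq0 p q (d : int) : lam p != lam q -> `|d| <= (hook sh)%:Z ->
  (lam p)%:R - (lam q)%:R + k * d%:~R != 0.
Proof.
move=> ne dh; have := k_small (n := (lam p)%:Z - (lam q)%:Z) _ dh.
by rewrite intrB -!pmulrn; apply; lia.
Qed.

Lemma swap_denom_neq0 p q : lam p != lam q -> (lam p)%:R - (lam q)%:R + k * ((contz TS p)%:~R - (contz TS q)%:~R) != 0.
Proof. by move=> ne; rewrite -intrB; apply: denom_neq0 => //; apply/ltW/contz_bound. Qed.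

Lemma contz_diff_neq0 p q : p != q -> lam p = lam q -> (contz TS p)%:~R - (contz TS q)%:~R != 0 :> C.
Proof. by move=> pq E; rewrite subr_eq0 eqr_int contz_seg. Qed.

(** Partial fractions for 1/((x_p - x_q)(x_p - x_r)) with x = xi/kappa. The cases by equal entries
    are forced by the cancelled kappa in [swap_coef], and they include kappa = 0. *)
Lemma swap_coef_triple p q r : p != q -> p != r -> q != r -> swap_coef p q * swap_coef p r = swap_coef q r * (swap_coef p q - swap_coef p r).
Proof.
move=> pq pr qr; rewrite /swap_coef (intrB _ (contz TS p) (contz TS q)).
rewrite (intrB _ (contz TS p) (contz TS r)) (intrB _ (contz TS q) (contz TS r)).
have [E1|N1] := eqVneq (lam p) (lam q); have [E2|N2] := eqVneq (lam p) (lam r).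
- rewrite -E1 E2 eqxx; have := contz_diff_neq0 pq E1; have := contz_diff_neq0 pr E2; have := @contz_diff_neq0 q r qr ltac:(congruence).
  move=> h1 h2 h3; field. by rewrite h1 h2 h3.
- have N3 : lam q != lam r by rewrite -E1.
  rewrite (negbTE N3); have := contz_diff_neq0 pq E1; have := swap_denom_neq0 N2; have := swap_denom_neq0 N3; rewrite -E1.
  move=> h1 h2 h3; field. by rewrite h1 h2 h3.
- have N3 : lam q != lam r by rewrite -E2 eq_sym.
  rewrite (negbTE N3); have := contz_diff_neq0 pr E2; have := swap_denom_neq0 N1; have := swap_denom_neq0 N3; rewrite -E2.
  move=> h1 h2 h3; field. by rewrite h1 h2 h3.
have [E3|N3] := eqVneq (lam q) (lam r).
  have := contz_diff_neq0 qr E3; have := swap_denom_neq0 N1; have := swap_denom_neq0 N2; rewrite -E3.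
  move=> h1 h2 h3; field. by rewrite h1 h2 h3.
have := swap_denom_neq0 N1; have := swap_denom_neq0 N2; have := swap_denom_neq0 N3.
move=> h1 h2 h3; field. by rewrite h1 h2 h3.
Qed.

Definition seg_coef p q : C := if same_seg p q then swap_coef p q else 0.

Lemma same_segC p q : same_seg p q = same_seg q p.
Proof. by rewrite /same_seg eq_sym [X in _ && X]eq_sym. Qed.

Lemma same_seg_trans p q r : same_seg p q -> same_seg q r = same_seg p r.
Proof. by rewrite /same_seg => /andP[/eqP -> /eqP ->]. Qed.

Lemma seg_coefN p q : seg_coef q p = - seg_coef p q.
Proof. by rewrite /seg_coef same_segC; case: ifP => _; rewrite ?oppr0 // swap_coefN. Qed.

(** [same_seg] is an equivalence relation: either the three cells share a segment or both sides
    vanish. *)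
Lemma seg_coef_triple p q r : p != q -> p != r -> q != r -> seg_coef p q * seg_coef p r = seg_coef q r * (seg_coef p q - seg_coef p r).
Proof.
move=> pq pr qr; have := swap_coef_triple pq pr qr; rewrite /seg_coef.
case: (boolP (same_seg p q)) => h1.
  by rewrite (same_seg_trans r h1); case: ifP => _ E //; rewrite !(mulr0, mul0r).
case: (boolP (same_seg p r)) => h2.
  rewrite -(same_seg_trans q h2) in h1.
  by rewrite [same_seg q r]same_segC (negbTE h1) !(mulr0, mul0r).
by rewrite subrr !(mulr0, mul0r).
Qed.

Definition seg_ordered s := [forall p : 'I_N, forall q : 'I_N, ((p < q)%N && same_seg p q) ==> (s^-1%g p < s^-1%g q)%N].

Lemma seg_orderedP s : reflect (forall p q, (p < q)%N -> same_seg p q -> (s^-1%g p < s^-1%g q)%N) (seg_ordered s).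
Proof.
apply: (iffP forallP) => h p; last by apply/forallP => q; apply/implyP => /andP[]; apply: h.
by move=> q h1 h2; have /forallP /(_ q) /implyP := h p; apply; rewrite h1.
Qed.

Lemma swap_coef_next p q : same_seg p q -> (val TS q).2 = (val TS p).2.+1 :> nat -> 1 + swap_coef p q = 0.
Proof.
move=> /andP[E /eqP r] h; rewrite /swap_coef E /contz r h.
have -> : ((val TS p).2%:Z - (val TS q).1%:Z - ((val TS p).2.+1%:Z - (val TS q).1%:Z) = -1 :> int)%R by lia.
by rewrite mulrN1z invrN1 subrr.
Qed.

(** The right neighbour of q lies weakly to the left of p, so its entry is squeezed between two
    equal ones. *)
Lemma seg_next p q : (p < q)%N -> same_seg p q ->
  exists r, [/\ same_seg r q, (r < q)%N, (p <= r)%N & (val TS r).2 = (val TS q).2.+1 :> nat].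
Proof.
move=> pq sg; have /andP[/eqP E /eqP r0] := sg.
have lt := seg_same sh_part lam_sorted TS_num pq E r0.
have cN : ((val TS q).2.+1 < N)%N by apply: leq_ltn_trans lt _.
have dr : in_diag sh ((val TS q).1, Ordinal cN).
  by apply: (in_diag_le sh_part (c := val TS p)); rewrite /= ?r0 //; apply: tab_diag.
have [r hr] := onto TS dr; exists r.
have lr : lam r = lam q.
  rewrite -!(fill_lam lam_sorted TS) hr; apply/eqP; rewrite eqn_leq; apply/andP; split.
    rewrite (fill_lam lam_sorted TS q) -E -(fill_lam lam_sorted TS p).
    rewrite [val TS p]surjective_pairing r0; apply: (colstrict_row sh_part cF) => //.
    by rewrite -r0 -surjective_pairing tab_diag.
  by rewrite {1}[val TS q]surjective_pairing; apply: (colstrict_row sh_part cF).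
have sgr : same_seg r q by rewrite /same_seg lr hr !eqxx.
split => //; rewrite ?hr //.
  have [//|h|/ord_inj h] := ltngtP r q.
    have := seg_same sh_part lam_sorted TS_num h (esym lr); rewrite hr /= => /(_ erefl); lia.
  by have := congr1 (fun x => nat_of_ord (val TS x).2) h; rewrite hr /=; lia.
rewrite leqNgt; apply/negP => h.
have := seg_same sh_part lam_sorted TS_num h; rewrite hr lr E r0 => /(_ erefl erefl) /=.
by move: lt => /=; lia.
Qed.

(** If all adjacent cells of segments were listed in the right order, chaining through [seg_next]
    would order every segment. *)
Lemma bad_adjacent s : ~~ seg_ordered s -> exists p q, [/\ same_seg p q,
   (val TS q).2 = (val TS p).2.+1 :> nat & (s^-1%g p < s^-1%g q)%N].
Proof.
move=> ng; case: (boolP [exists p : 'I_N, exists q : 'I_N,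
   [&& same_seg p q, (val TS q).2 == (val TS p).2.+1 :> nat & (s^-1%g p < s^-1%g q)%N]]).
  by move=> /existsP[p /existsP[q /and3P[h1 /eqP h2 h3]]]; exists p, q.
move=> none; case/negP: ng; apply/seg_orderedP => p q pq.
have [n] := ubnP (q - p)%N; elim: n q pq => // n IH q pq /ltnSE le sg.
have [r [sr rq pr h]] := seg_next pq sg.
have lt : (s^-1%g r < s^-1%g q)%N.
  move: none; rewrite negb_exists => /forallP /(_ q); rewrite negb_exists => /forallP /(_ r).
  rewrite same_segC sr h eqxx /= -leqNgt leq_eqVlt => /orP[/eqP/ord_inj/perm_inj E|//].
  by rewrite E ltnn in rq.
move: pr; rewrite leq_eqVlt => /orP[/eqP/ord_inj -> //|pr].
apply: ltn_trans lt; apply: IH => //; first lia.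
by rewrite -(same_seg_trans r sg) same_segC.
Qed.

(** Only the values of b inside segments matter here, so the result applies to [swap_coef] and to
    [seg_coef]. *)
Lemma bad_vanish s (b : 'I_N -> 'I_N -> C) : (forall p q, same_seg p q -> b p q = swap_coef p q) ->
  ~~ seg_ordered s -> pprod (fun i j => 1 + b (s i) (s j)) = 0.
Proof.
move=> bE /bad_adjacent[p [q [sg h lt]]].
rewrite pprodE (bigD1 (s^-1%g p, s^-1%g q)) //= !permKV bE // swap_coef_next // mul0r.
by [].
Qed.

Lemma sum_seg_ordered (b : 'I_N -> 'I_N -> C) : (forall p q, same_seg p q -> b p q = swap_coef p q) ->
  (forall p q, b q p = - b p q) ->
  (forall p q r, p != q -> p != r -> q != r -> b p q * b p r = b q r * (b p q - b p r)) ->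
  \sum_(s | seg_ordered s) pprod (fun i j => 1 + b (s i) (s j)) = (N`!)%:R.
Proof.
move=> bE bN b3; rewrite -(sum_perm_pairs bN b3) [RHS](bigID seg_ordered) /=.
by rewrite [X in _ = _ + X]big1 ?addr0 // => s /(bad_vanish bE).
Qed.

(** An ordered word inverts no pair inside a segment and the other factors are 1. All ordered words
    thus contribute equally, and the sum counts them. *)
Lemma seg_ordered_prod (b : 'I_N -> 'I_N -> C) s : seg_ordered s -> (forall p q, ~~ same_seg p q -> b p q = 0) ->
  pprod (fun i j => 1 + b (s i) (s j)) = pprod (fun p q => 1 + b p q).
Proof.
move=> /seg_orderedP gs b0; rewrite (pprod_perm s (fun p q => 1 + b p q)); apply: eq_pprod => p q pq.
case: ifP => // iv; case: (boolP (same_seg p q)) => sg.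
  by have := gs _ _ pq sg; move: iv; rewrite /inverted; lia.
by rewrite !b0 // same_segC.
Qed.

Lemma card_seg_ordered : #|seg_ordered|%:R * pprod (fun p q => 1 + seg_coef p q) = (N`!)%:R.
Proof.
have bE p q : same_seg p q -> seg_coef p q = swap_coef p q by rewrite /seg_coef => ->.
rewrite -(sum_seg_ordered bE seg_coefN seg_coef_triple) (eq_bigr (fun _ => pprod (fun p q => 1 + seg_coef p q))).
  by rewrite sumr_const mulr_natl.
by move=> s gs; apply: seg_ordered_prod => // p q; rewrite /seg_coef => /negbTE ->.
Qed.

(* The pair (beta, T') encoded by s; [word_tab] falls back to TS when s does not
   list the row segments in the right order. *)
Definition word_mono s : mono N := permm lam s.
Definition word_raw s : rawtab N := [ffun l => val TS (s ((rank_perm (word_mono s))^-1%g l))].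
Definition word_tab s : tab N sh := insubd TS (word_raw s).

(** Along a row, different entries are ordered by rank and equal ones by the order of the segment in
    s. Down a column entries are strict, so the rank alone decides. *)
Lemma word_raw_rsyt s : seg_ordered s -> is_rsyt sh (word_raw s).
Proof.
move=> /seg_orderedP gs; apply/and4P; split.
- by apply/injectiveP => x y; rewrite !ffunE => /(@tab_inj _ _ TS) /perm_inj /perm_inj.
- by apply/forallP => x; rewrite ffunE; apply: tab_diag.
- apply/forallP => x; apply/forallP => y; apply/implyP; rewrite !ffunE.
  set i := ((rank_perm (word_mono s))^-1%g x); set j := ((rank_perm (word_mono s))^-1%g y); move=> /andP[/eqP r lt].
  have -> : x = rank_perm (word_mono s) i by rewrite permKV.
  have -> : y = rank_perm (word_mono s) j by rewrite permKV.
  rewrite rank_perm_lt /precedes !ffunE.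
  have : (lam (s i) <= lam (s j))%N.
    rewrite -!(fill_lam lam_sorted TS) [val TS (s i)]surjective_pairing.
    rewrite [val TS (s j)]surjective_pairing r; apply: (colstrict_row sh_part cF); first exact: ltnW.
    by rewrite -surjective_pairing tab_diag.
  rewrite leq_eqVlt => /orP[/eqP E|->//]; rewrite E ltnn eqxx /=.
  have sg : same_seg (s j) (s i) by rewrite /same_seg E r !eqxx.
  have [h|h|/ord_inj h] := ltngtP (s i) (s j).
  - by have := seg_same sh_part lam_sorted TS_num h E r; rewrite ltnNge (ltnW lt).
  - by have := gs _ _ h sg; rewrite !permK.
  by rewrite h ltnn in lt.
apply/forallP => x; apply/forallP => y; apply/implyP; rewrite !ffunE.
set i := ((rank_perm (word_mono s))^-1%g x); set j := ((rank_perm (word_mono s))^-1%g y); move=> /andP[/eqP r lt].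
have -> : x = rank_perm (word_mono s) i by rewrite permKV.
have -> : y = rank_perm (word_mono s) j by rewrite permKV.
rewrite rank_perm_lt /precedes !ffunE; apply/orP; left.
rewrite -!(fill_lam lam_sorted TS) [val TS (s i)]surjective_pairing.
rewrite [val TS (s j)]surjective_pairing r; apply: (colstrict_col sh_part cF) => //.
by rewrite -surjective_pairing tab_diag.
Qed.

Lemma word_tabE s : seg_ordered s -> val (word_tab s) = word_raw s.
Proof. by move=> gs; rewrite /word_tab val_insubd word_raw_rsyt. Qed.

Lemma word_tab_contz s i : seg_ordered s -> contz (word_tab s) (rank_perm (word_mono s) i) = contz TS (s i).
Proof. by move=> gs; rewrite /contz word_tabE // ffunE permK. Qed.

Lemma seg_ordered1 : seg_ordered 1%g.
Proof. by apply/seg_orderedP => p q pq _; rewrite invg1 !perm1. Qed.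

Lemma word_mono1 : word_mono 1%g = lam.
Proof. by apply/ffunP => i; rewrite ffunE perm1. Qed.

Lemma word_tab1 : word_tab 1%g = TS.
Proof.
apply: val_inj; rewrite word_tabE ?seg_ordered1 //; apply/ffunP => l; rewrite ffunE word_mono1.
by rewrite rank_perm_sorted // invg1 !perm1.
Qed.

Lemma Tset_words : perm_eq (Tset lam TS) [seq (word_mono s, word_tab s) | s <- enum seg_ordered].
Proof.
apply: uniq_perm.
- rewrite filter_uniq //; apply: allpairs_uniq; rewrite ?undup_uniq ?enum_uniq //.
  by move=> [a b] [a' b'].
- rewrite map_inj_in_uniq ?enum_uniq // => s t; rewrite !mem_enum => gs gt [E1 E2].
  have E3 := congr1 val E2; rewrite !word_tabE // in E3.
  apply/permP => i; have := congr1 (fun f : rawtab N => f (rank_perm (word_mono s) i)) E3.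
  by rewrite !ffunE -E1 permK => /(@tab_inj _ _ TS).
move=> [b T']; apply/idP/mapP; last first.
  move=> [s]; rewrite mem_enum => gs [-> ->]; rewrite mem_filter; apply/andP; split.
    apply/forallP => d /=; apply/eqP.
    case: (boolP (in_diag sh d)) => dd; last first.
      rewrite /fill; case: pickP => [x /eqP E|_]; first by rewrite -E tab_diag in dd.
      by case: pickP => [x /eqP E|//]; rewrite -E tab_diag in dd.
    have [x <-] := onto (word_tab s) dd; rewrite fillE word_tabE // ffunE (fill_lam lam_sorted).
    by rewrite -{1}[x](permKV (rank_perm (word_mono s))) nth_plusm ffunE.
  apply/allpairsP; exists (word_mono s, word_tab s); split; rewrite //= ?mem_enum //.
  rewrite mem_undup; apply/mapP; exists s; rewrite ?mem_enum //.
rewrite mem_filter => /andP[/forallP fl /allpairsP[[b' T''] /= [bw _ [Eb ET]]]].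
subst b' T''; move: bw; rewrite mem_undup => /mapP[w _ bw].
have /fin_all_exists[f fE] : forall i, exists p, val TS p = val T' (rank_perm b i).
  by move=> i; apply: onto; apply: tab_diag.
have f_inj : injective f.
  by move=> i j ij; have := fE i; rewrite ij fE => /(@tab_inj _ _ T') /perm_inj.
pose s := perm f_inj.
have sE i : val TS (s i) = val T' (rank_perm b i) by rewrite permE fE.
have bE : b = word_mono s.
  apply/ffunP => i; rewrite ffunE -(fill_lam lam_sorted TS) sE.
  by have /eqP <- := fl (val T' (rank_perm b i)); rewrite fillE nth_plusm.
(* T' decreases along rows. As the entries of p and q agree, comparing their ranks means comparing
   their positions in s. *)
have gs : seg_ordered s.
  apply/seg_orderedP => p q pq /andP[/eqP E /eqP r].
  have lt := seg_same sh_part lam_sorted TS_num pq E r.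
  set i := s^-1%g p; set j := s^-1%g q.
  have pE : val TS p = val T' (rank_perm b i) by rewrite -sE permKV.
  have qE : val TS q = val T' (rank_perm b j) by rewrite -sE permKV.
  have := @tab_row _ _ T' (rank_perm b j) (rank_perm b i).
  rewrite -pE -qE r => /(_ erefl lt); rewrite rank_perm_lt /precedes bE !ffunE !permKV E ltnn eqxx.
  by [].
exists s; first by rewrite mem_enum.
congr (_, _); first exact: bE.
apply: val_inj; rewrite word_tabE //; apply/ffunP => l; rewrite ffunE -bE sE.
by rewrite permKV.
Qed.

(** Positions i < j with beta_i < beta_j are the inversions between different entries, and the rank
    leads back to the contents of the cells. *)
Lemma Eeps_word s (e : C) : seg_ordered s -> Eeps k e (word_mono s) (word_tab s) =
  pprod (fun p q => if inverted s p q && (lam q < lam p)%N then 1 + e * swap_coef p q else 1).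
Proof.
move=> gs; pose G p q : C := if (lam p < lam q)%N then 1 + e * swap_coef q p else 1.
transitivity (pprod (fun i j => G (s i) (s j))).
  rewrite /Eeps pprod_if; apply: eq_pprod => i j ij; rewrite /G !ffunE.
  case: ifP => // lt; rewrite !contnE !word_tab_contz // /swap_coef.
  have -> : (lam (s j) == lam (s i)) = false by lia.
  by rewrite mulrA.
rewrite pprod_perm; apply: eq_pprod => p q pq; rewrite /G; case: (boolP (inverted s p q)) => //= _.
by have := lam_sorted (ltnW pq); case: ltngtP.
Qed.

(** T' is T_S renumbered by u, which moves indices only inside blocks of equal lambda. Hence u
    inverts exactly the pairs of equal entries that s inverts. *)
Lemma Ceps_word s (e : C) : seg_ordered s -> Ceps e (word_tab s) =
  pprod (fun p q => if (lam p == lam q) && inverted s p q then content_factor TS e q p else content_factor TS e p q).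
Proof.
move=> gs; pose u := ((rank_perm (word_mono s))^-1 * s)%g.
have uc x : contz (word_tab s) x = contz TS (u x).
  by rewrite -{1}[x](permKV (rank_perm (word_mono s))) word_tab_contz // /u permM.
transitivity (pprod (fun x y => content_factor TS e (u x) (u y))).
  by rewrite /Ceps pprod_if; apply: eq_pprod => x y xy; rewrite /content_factor !uc.
rewrite pprod_perm; apply: eq_pprod => p q pq.
have -> // : inverted u p q = (lam p == lam q) && inverted s p q.
rewrite /inverted /u invMg invgK !permM rank_perm_lt /precedes !ffunE !permKV eq_sym.
by have := lam_sorted (ltnW pq); case: ltngtP.
Qed.

Lemma content_factor_diff p q (e : C) : (p < q)%N -> lam p = lam q -> (val TS p).1 != (val TS q).1 ->
  content_factor TS e p q = 1 + e * swap_coef p q /\ content_factor TS e q p = 1.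
Proof.
move=> pq E r; have h := seg_diff sh_part lam_sorted cF TS_num pq E r.
rewrite /content_factor /swap_coef h E eqxx; split=> //; case: ifP => //; lia.
Qed.

Lemma inverted_diff s p q : seg_ordered s -> (p < q)%N -> lam p = lam q -> inverted s p q -> (val TS p).1 != (val TS q).1.
Proof.
move=> /seg_orderedP gs pq E; apply: contraTneq => r; rewrite /inverted -leqNgt ltnW //.
by apply: gs => //; rewrite /same_seg E r !eqxx.
Qed.

(** The quotient of the [Ceps] supplies the inversions between equal entries, [Eeps] those between
    different ones. *)
Lemma coef_word s : seg_ordered s ->
  Ceps (-1) TS / Ceps (-1) (word_tab s) * Eeps k (-1) (word_mono s) (word_tab s) =
  pprod (fun p q => if inverted s p q then 1 - swap_coef p q else 1).
Proof.
move=> gs; rewrite -{1}word_tab1 !Ceps_word ?seg_ordered1 // Eeps_word // pprodV !pprodM.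
apply: eq_pprod => p q pq.
have -> : inverted 1%g p q = false by rewrite /inverted invg1 !perm1; lia.
rewrite andbF; have g0 := @content_factor_neq0 C N sh TS (-1) p q (or_intror erefl).
have := lam_sorted (ltnW pq); rewrite leq_eqVlt => /orP[/eqP E|lt].
  rewrite E eqxx ltnn andbF mulr1 /=; case: ifP => iv; last by rewrite divff.
  have [-> ->] := @content_factor_diff p q (-1) pq (esym E) (inverted_diff gs pq (esym E) iv).
  by rewrite divr1 mulN1r.
have -> /= : (lam p == lam q) = false by lia.
by rewrite divff // lt andbT mul1r mulN1r.
Qed.

Lemma swap_coef_real p q : Num.conj k = k -> Num.conj (swap_coef p q) = swap_coef p q.
Proof.
move=> kr; rewrite /swap_coef; case: ifP => _; first by rewrite fmorphV rmorph_int.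
by rewrite rmorphM fmorphV !(rmorphD, rmorphN, rmorphM, rmorph_nat, rmorph_int) /= kr.
Qed.

(** For different entries the content difference shifted by e is still at most h_tau in absolute
    value. For equal entries in different rows the difference is at most -2. Inside a segment it is
    positive and equals 1 for neighbours, which rules out e = -1. *)
Lemma swap_coef_neq0 p q (e : int) : (p < q)%N -> e = 1 \/ e = -1 /\ ~~ same_seg p q ->
  1 + e%:~R * swap_coef p q != 0.
Proof.
move=> pq he; have e1 : `|e| = 1 by case: he => [->|[->]].
rewrite /swap_coef; have [E|ne] := eqVneq (lam p) (lam q); last first.
  have h0 := swap_denom_neq0 ne; rewrite intrB.
  have -> : 1 + e%:~R * (k / ((lam p)%:R - (lam q)%:R + k * ((contz TS p)%:~R - (contz TS q)%:~R))) =
    ((lam p)%:R - (lam q)%:R + k * (contz TS p - contz TS q + e)%:~R) /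
    ((lam p)%:R - (lam q)%:R + k * ((contz TS p)%:~R - (contz TS q)%:~R)).
    by rewrite intrD intrB; field.
  rewrite mulf_neq0 ?invr_neq0 //; apply: denom_neq0 => //.
  by have := contz_bound sh_part TS TS p q; lia.
have pq' : p != q by apply: contraTneq pq => ->; rewrite ltnn.
have := contz_seg pq' E; have := contz_diff_neq0 pq' E; rewrite -intrB => d0 _.
set d := contz TS p - contz TS q in d0 *.
have -> : 1 + e%:~R * (d%:~R)^-1 = (d + e)%:~R / d%:~R :> C by rewrite intrD; field.
rewrite mulf_neq0 ?invr_neq0 // intr_eq0.
case: (eqVneq (val TS p).1 (val TS q).1) => r.
  have := seg_same sh_part lam_sorted TS_num pq E r; case: he => [->|[_ /negP[]]].
    by rewrite /d /contz r; lia.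
  by rewrite /same_seg E r !eqxx.
have := seg_diff sh_part lam_sorted cF TS_num pq E r; rewrite /d.
by case: he => [->|[-> _]]; lia.
Qed.

End Words.

(** * Norms along words, the norm of J, and the role of T_R *)

Section Assembly.
Variables (C : numClosedFieldType) (N : nat) (sh : seq nat) (k : C).
Hypothesis sh_part : is_partition N sh.
Hypothesis onto : forall T : tab N sh, onto_diag T.
Variable rho : {perm 'I_N} -> vmat C N sh.
Hypothesis rhoP : is_young_rep rho.
Hypothesis k_small : forall n d : int, n != 0 -> `|d| <= (hook sh)%:Z -> n%:~R + k * d%:~R != 0.
Hypothesis k_real : Num.conj k = k.
Variable H : vpoly C N sh -> vpoly C N sh -> C.
Hypothesis HP : is_form k rho H.
Variable zeta : mono N -> tab N sh -> vpoly C N sh.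
Hypothesis zetaP : forall a T, is_zeta k rho a T (zeta a T).
Variable lam : mono N.
Hypothesis lam_sorted : forall i j : 'I_N, (i <= j)%N -> (lam j <= lam i)%N.
Variables TS TR : tab N sh.
Hypothesis cF : colstrict sh (fill lam TS).
Hypothesis TS_num : is_numbered (TSnum sh (fill lam TS)) TS.
Hypothesis TR_num : is_numbered (TRnum sh (fill lam TS)) TR.
Hypothesis TR_fill : fill lam TR = fill lam TS.
Implicit Types (p q : 'I_N) (s : {perm 'I_N}).

Local Notation seg_ordered := (@seg_ordered N sh lam TS).
Local Notation b := (swap_coef k lam TS).
Local Notation beta := (word_mono lam).
Local Notation tw := (word_tab lam TS).
Local Notation zw := (fun s => zeta (beta s) (tw s)).

Lemma invertedN s p q : p != q -> (s^-1%g p < s^-1%g q)%N = ~~ inverted s p q.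
Proof.
move=> pq; rewrite /inverted; have : s^-1%g p <> s^-1%g q :> nat; last lia.
by move=> /ord_inj /perm_inj E; rewrite E eqxx in pq.
Qed.

(** Exchanging two adjacent letters changes the relative order of that pair only. *)
Lemma inverted_swap s (i j x y : 'I_N) : j = i.+1 :> nat -> (s j < s i)%N -> (s x < s y)%N ->
  inverted (tperm i j * s)%g (s x) (s y) = inverted s (s x) (s y) && ((s x, s y) != (s j, s i)).
Proof.
move=> ij lt pq; rewrite /inverted invMg tpermV !permM xpair_eqE !permK !(inj_eq perm_inj).
have neq (u v : 'I_N) : u <> v -> nat_of_ord u <> v by move=> h /ord_inj.
have e1 : (x == j) = (nat_of_ord x == j) by [].
have e2 : (y == i) = (nat_of_ord y == i) by [].
rewrite e1 e2; case: (tpermP i j x) => [xE|xE|/neq ? /neq ?];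
  case: (tpermP i j y) => [yE|yE|/neq ? /neq ?]; rewrite ?xE ?yE in pq *; lia.
Qed.

Lemma seg_ordered_swap s (i j : 'I_N) : j = i.+1 :> nat -> (s j < s i)%N -> seg_ordered s ->
  seg_ordered (tperm i j * s)%g.
Proof.
move=> ij lt /seg_orderedP gs; apply/seg_orderedP => p q pq sg.
have ne : p != q by apply: contraTneq pq => ->; rewrite ltnn.
have := gs p q pq sg; rewrite !invertedN //.
rewrite -(permKV s p) -(permKV s q) in pq *.
by rewrite inverted_swap // => /negbTE ->.
Qed.

Lemma pprod_swap s (i j : 'I_N) (G : 'I_N -> 'I_N -> C) : j = i.+1 :> nat -> (s j < s i)%N ->
  pprod (fun p q => if inverted s p q then G p q else 1) =
  G (s j) (s i) * pprod (fun p q => if inverted (tperm i j * s)%g p q then G p q else 1).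
Proof.
move=> ij lt; rewrite !pprodE (bigD1 (s j, s i)) //= [in RHS](bigD1 (s j, s i)) //=.
rewrite inverted_swap // eqxx andbF mul1r {1}/inverted !permK ij leqnn; congr (_ * _).
apply: eq_bigr => -[p q] /= /andP[pq ne].
rewrite -(permKV s p) -(permKV s q) in pq ne *.
by rewrite inverted_swap // ne andbT.
Qed.

Lemma inverted_card_swap s (i j : 'I_N) : j = i.+1 :> nat -> (s j < s i)%N ->
  (#|[pred x : 'I_N * 'I_N | (x.1 < x.2)%N && inverted (tperm i j * s)%g x.1 x.2]| <
   #|[pred x : 'I_N * 'I_N | (x.1 < x.2)%N && inverted s x.1 x.2]|)%N.
Proof.
move=> ij lt; apply/proper_card/properP; split.
  apply/subsetP => -[p q]; rewrite !inE /= => /andP[pq]; rewrite pq /=.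
  by rewrite -(permKV s p) -(permKV s q) in pq *; rewrite inverted_swap // => /andP[].
exists (s j, s i); rewrite !inE /= lt /=; first by rewrite /inverted !permK ij.
by rewrite inverted_swap // eqxx andbF.
Qed.

(** If the two letters have different entries, beta changes and the tableau stays; if the entries
    agree, beta stays and the tableau changes. Each case has its own norm step, with the same factor
    in terms of b. *)
Lemma norm_word_step s (i j : 'I_N) : j = i.+1 :> nat -> (s j < s i)%N -> seg_ordered s ->
  H (zw (tperm i j * s)%g) (zw (tperm i j * s)%g) = (1 - b (s j) (s i) ^+ 2) * H (zw s) (zw s).
Proof.
move=> ij lt gs; have gs' := seg_ordered_swap ij lt gs.
have betaE : beta (tperm i j * s)%g = permm (beta s) (tperm i j).
  by apply/ffunP => x; rewrite !ffunE permM.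
have := lam_sorted (ltnW lt); rewrite leq_eqVlt => /orP[/eqP E|llt]; last first.
  have blt : (beta s i < beta s j)%N by rewrite !ffunE.
  have tabE : tw (tperm i j * s)%g = tw s.
    apply: val_inj; rewrite !word_tabE //; apply/ffunP => l; rewrite !ffunE betaE.
    rewrite rank_perm_tperm //; last by rewrite neq_ltn blt.
    by rewrite invMg tpermV !permM tpermK.
  rewrite /= betaE tabE (zeta_norm_step sh_part onto rhoP k_small k_real HP zetaP _ ij blt).
  congr ((1 - _) * _); rewrite swap_coefN sqrrN; congr (_ ^+ 2).
  rewrite /swap_coef /spectral !word_tab_contz // !ffunE.
  have -> : (lam (s i) == lam (s j)) = false by lia.
  by rewrite intrB; congr (_ / _); ring.
have beq : beta s i = beta s j by rewrite !ffunE.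
have betaE' : beta (tperm i j * s)%g = beta s by rewrite betaE permm_tperm_eq.
have ivs : inverted s (s j) (s i) by rewrite /inverted !permK ij.
have r := inverted_diff gs lt (esym E) ivs.
have cd := seg_diff sh_part lam_sorted cF TS_num lt (esym E) r.
have tabE : val (tw (tperm i j * s)%g) =
  [ffun l => val (tw s) (tperm (rank_perm (beta s) i) (rank_perm (beta s) j) l)].
  rewrite !word_tabE //; apply/ffunP => l; rewrite !ffunE betaE' permM; congr (val TS (s _)).
  rewrite -{2}[l](permKV (rank_perm (beta s))) -(inj_tperm _ _ _ (@perm_inj _ (rank_perm (beta s)))).
  by rewrite permK.
rewrite /= betaE' (zeta_norm_step_eq sh_part onto rhoP k_small k_real HP zetaP ij beq _ tabE) !word_tab_contz //.
  congr ((1 - _) * _); rewrite [in RHS]swap_coefN sqrrN; congr (_ ^+ 2).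
  by rewrite /swap_coef E eqxx.
lia.
Qed.

(** Undoing descents one by one leads to the identity word, which encodes (lambda, T_S). Each step
    removes one inversion and its factor 1 - b^2; the product form avoids division. *)
Lemma norm_word s : seg_ordered s ->
  H (zw s) (zw s) * pprod (fun p q => if inverted s p q then 1 - b p q ^+ 2 else 1) =
  H (zeta lam TS) (zeta lam TS).
Proof.
have [n] := ubnP #|[pred x : 'I_N * 'I_N | (x.1 < x.2)%N && inverted s x.1 x.2]|.
elim: n s => // n IH s /ltnSE le gs.
have [->|s1] := eqVneq s 1%g.
  rewrite /= word_mono1 word_tab1 // pprodE big1 ?mulr1 // => x xx.
  by rewrite /inverted invg1 !perm1 ltnNge ltnW.
have [i [j [ij lt]]] := perm_descent s1.
rewrite (pprod_swap _ ij lt) mulrA [_ * (1 - _)]mulrC -norm_word_step //.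
by apply: IH; [apply: leq_trans (inverted_card_swap ij lt) le|apply: seg_ordered_swap].
Qed.

(** If two words give the same beta, they differ at a position where the cells have equal entries.
    Such cells have different contents, which separates the tableaux. *)
Lemma word_orth s t : seg_ordered s -> seg_ordered t -> s != t -> H (zw s) (zw t) = 0.
Proof.
move=> gs gt st; apply: (zeta_orth sh_part rhoP k_small k_real HP zetaP).
  by rewrite !degm_permm.
have [E|ne] := eqVneq (beta s) (beta t); last by left.
have [i si] : exists i, s i != t i.
  apply/existsP; rewrite -negb_forall; apply: contra st => /forallP h.
  by apply/eqP/permP => i; apply/eqP.
have ll : lam (s i) = lam (t i) by have := congr1 (fun f : mono N => f i) E; rewrite !ffunE.
have cd := contz_seg sh_part lam_sorted cF TS_num si ll.
rewrite -(word_tab_contz sh_part lam_sorted cF TS_num i gs) -(word_tab_contz sh_part lam_sorted cF TS_num i gt) -E in cd.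
right; split=> //; split; last by move=> _; exists (rank_perm (beta s) i).
by apply: contraNneq cd => ->.
Qed.

Let A s : C := Ceps (-1) TS / Ceps (-1) (tw s) * Eeps k (-1) (beta s) (tw s).

Lemma Jpoly_words : Jpoly k zeta lam TS =
  fun c T => \sum_(s <- index_enum {perm 'I_N} | seg_ordered s) A s * zw s c T.
Proof.
apply: vpoly_ext => c T; rewrite /Jpoly (perm_big _ (Tset_words sh_part onto lam_sorted cF TS_num)).
by rewrite big_map big_enum.
Qed.

Lemma form_Jpoly : H (Jpoly k zeta lam TS) (Jpoly k zeta lam TS) =
  \sum_(s | seg_ordered s) A s ^+ 2 * H (zw s) (zw s).
Proof.
have hz s : homog (degm lam) (zw s).
  by rewrite -(degm_permm lam s); apply: zeta_homog.
have hJ : homog (degm lam) (Jpoly k zeta lam TS) by rewrite Jpoly_words; apply: homog_sum.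
have Ar s : seg_ordered s -> Num.conj (A s) = A s.
  move=> gs; rewrite /A (coef_word k sh_part lam_sorted cF TS_num gs) /pprod.
  rewrite rmorph_prod; apply: eq_bigr => p _; rewrite rmorph_prod; apply: eq_bigr => q _.
  by case: ifP => _; rewrite ?rmorph1 // rmorphB rmorph1 /= swap_coef_real.
rewrite {1}Jpoly_words (form_suml HP _ _ _ hJ hz); apply: eq_bigr => s gs.
rewrite Ar // expr2 -mulrA; congr (_ * _).
rewrite Jpoly_words (form_sumr HP _ _ _ (hz s) hz) (bigD1 s) //= big1 ?addr0 // => t /andP[gt ts].
by rewrite word_orth ?mulr0 // eq_sym.
Qed.

(** At an inversion (1 - b)^2 (1 + b) = (1 - b^2)(1 - b): [norm_word] absorbs the first factor, and
    the second is 1 + b(q,p), the factor of that pair in the word. Other pairs have 1 + b on both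
    sides. What is left is the permutation sum. *)
Lemma form_Jpoly_D : H (Jpoly k zeta lam TS) (Jpoly k zeta lam TS) * pprod (fun p q => 1 + b p q) =
  H (zeta lam TS) (zeta lam TS) * (N`!)%:R.
Proof.
have b3 := swap_coef_triple sh_part k_small lam_sorted cF TS_num.
rewrite -(sum_seg_ordered sh_part onto lam_sorted cF TS_num (fun p q _ => erefl (b p q)) (@swap_coefN _ _ _ k lam TS) b3).
rewrite form_Jpoly mulr_suml mulr_sumr; apply: eq_bigr => s gs.
rewrite -(norm_word gs) /A (coef_word k sh_part lam_sorted cF TS_num gs).
rewrite (pprod_perm s (fun p q => 1 + b p q)) mulrAC -[RHS]mulrA [RHS]mulrC; congr (_ * _).
rewrite expr2 !pprodM; apply: eq_pprod => p q pq; case: ifP => _; last by ring.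
by rewrite [b q p]swap_coefN; ring.
Qed.

Lemma TR_word : exists2 s, seg_ordered s & beta s = minusm lam /\ tw s = TR.
Proof.
have : (minusm lam, TR) \in Tset lam TS.
  rewrite mem_filter; apply/andP; split.
    by apply/forallP => d /=; rewrite /fill plusm_minusm -/(fill lam TR d) TR_fill.
  apply/allpairsP; exists (minusm lam, TR); split; rewrite //= ?mem_enum //.
  rewrite mem_undup; apply/mapP.
  exists (rank_perm (minusm lam) * (rank_perm lam)^-1)%g; rewrite ?mem_enum //.
  by apply: plusm_eq_permm; rewrite plusm_minusm.
rewrite (perm_mem (Tset_words sh_part onto lam_sorted cF TS_num)) => /mapP[s].
by rewrite mem_enum => gs [E1 E2]; exists s.
Qed.

Lemma pprod_ratio : pprod (fun p q => 1 + b p q) * Ceps 1 TR =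
  pprod (fun p q => 1 + seg_coef k lam TS p q) * (Ceps 1 TS * Eeps k 1 (minusm lam) TR).
Proof.
have [s gs [bE tE]] := TR_word.
rewrite -tE -bE Eeps_word // (Ceps_base TS) Ceps_word // !pprodM.
apply: eq_pprod => p q pq.
rewrite mul1r; have := lam_sorted (ltnW pq); rewrite leq_eqVlt => /orP[/eqP E|lt].
  rewrite E eqxx ltnn andbF mulr1 /seg_coef /same_seg E eqxx /=.
  have [r|r] := eqVneq (val TS p).1 (val TS q).1.
    case: ifP => // iv; by have := inverted_diff gs pq (esym E) iv; rewrite r eqxx.
  have [-> ->] := content_factor_diff k sh_part lam_sorted cF TS_num 1 pq (esym E) r.
  (* From p to q the contents increase, since T_S numbers p first, whereas T_R lists equal entries
     by decreasing content. So q comes before p. *)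
  have -> : inverted s p q; last by rewrite mulr1 addr0 !mul1r.
  rewrite -[inverted s p q]negbK -invertedN; last by apply: contraTneq pq => ->; rewrite ltnn.
  apply/negP => h.
  have h' : (rank_perm (beta s) (s^-1%g p) < rank_perm (beta s) (s^-1%g q))%N.
    by rewrite rank_perm_lt /precedes !ffunE !permKV E h eqxx orbT.
  have := TR_order sh_part lam_sorted cF TR_num TR_fill h'.
  have lE x : lam (rank_perm (beta s) x) = lam (s x).
    have := nth_plusm (beta s) x; rewrite plusm_permm ffunE => <-.
    by rewrite -[in LHS](nth_plusm lam _) (rank_perm_sorted lam_sorted) perm1.
  rewrite !lE !permKV => /(_ (esym E)); rewrite -tE !word_tab_contz // !permKV.
  have := seg_diff sh_part lam_sorted cF TS_num pq (esym E) r; lia.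
have ne : (lam p == lam q) = false by lia.
rewrite ne /= /seg_coef /same_seg ne /= addr0 mul1r lt andbT mulrC.
(* lambda^- is nondecreasing, so the smaller entry, that of q, is listed first. *)
have -> : inverted s p q; last by [].
rewrite /inverted ltnNge; apply/negP; rewrite leq_eqVlt => /orP[/eqP/ord_inj/perm_inj h|h].
  by rewrite h ltnn in pq.
have := @minusm_sorted _ lam _ _ (ltnW h); rewrite -bE !ffunE !permKV; lia.
Qed.

Lemma norm_formula : H (Jpoly k zeta lam TS) (Jpoly k zeta lam TS) =
    (size (Tset lam TS))%:R *
      (Ceps 1 TR / (Ceps 1 TS * Eeps k 1 (minusm lam) TR)) *
      H (zeta lam TS) (zeta lam TS).
Proof.
have unit1 p q : (p < q)%N -> 1 + b p q != 0.
  move=> pq; have := swap_coef_neq0 sh_part k_small lam_sorted cF TS_num pq (or_introl erefl).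
  by rewrite mul1r.
have D0 : pprod (fun p q => 1 + b p q) != 0 by apply: pprod_neq0.
have C0 : Ceps 1 TS != 0 :> C.
  rewrite (Ceps_base TS); apply: pprod_neq0 => p q _.
  by apply: content_factor_neq0; left.
have E0 : Eeps k 1 (minusm lam) TR != 0.
  have [s gs [<- <-]] := TR_word; rewrite Eeps_word //; apply: pprod_neq0 => p q pq.
  by case: ifP => _; rewrite ?oner_neq0 // mul1r unit1.
have sz : size (Tset lam TS) = #|seg_ordered|.
  by rewrite (perm_size (Tset_words sh_part onto lam_sorted cF TS_num)) size_map -cardE.
apply: (mulIf D0); rewrite form_Jpoly_D -(card_seg_ordered sh_part onto k_small lam_sorted cF TS_num) sz.
have R := pprod_ratio; have -> : Ceps 1 TR = pprod (fun p q => 1 + seg_coef k lam TS p q) *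
   (Ceps 1 TS * Eeps k 1 (minusm lam) TR) / pprod (fun p q => 1 + b p q).
  by rewrite -R mulrC mulKf.
by field; rewrite D0 C0 E0.
Qed.

End Assembly.

(** * The bound on kappa and the conclusion *)

(** The order of C is partial, and comparability with a real number makes kappa real. Moreover
    |kappa d| < 1, while a nonzero integer has absolute value at least 1. *)
Lemma int_lin_neq0 (C : numClosedFieldType) (h : nat) (k : C) :
  - (h%:R)^-1 < k < (h%:R)^-1 ->
  Num.conj k = k /\ forall n d : int, n != 0 -> `|d| <= h%:Z -> n%:~R + k * d%:~R != 0.
Proof.
move=> kb; have h0 : (0 < h)%N.
  (* For h = 0 the convention 0^-1 = 0 would leave an empty interval for kappa. *)
  by case: h kb => // /andP[h1 h2]; have := lt_trans h1 h2; rewrite invr0 oppr0 ltxx.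
have hr : (h%:R : C)^-1 \is Num.real by rewrite rpredV realn.
have kr : k \is Num.real by case/andP: kb => _ /ltW /ler_real ->.
split; first exact/CrealP.
move=> n d n0 dh; apply/eqP => /eqP; rewrite addr_eq0 => /eqP E.
have kn : `|k| < (h%:R)^-1 by rewrite real_ltr_norml.
have : `|n%:~R| < 1 :> C.
  rewrite E normrN normrM -intr_norm; apply: (@le_lt_trans _ _ (`|k| * h%:R)).
    by apply: ler_wpM2l; rewrite ?normr_ge0 // -[h%:R]/(h%:Z%:~R) ler_int.
  by rewrite -ltr_pdivlMr ?ltr0n // div1r.
rewrite -intr_norm -[1]/(1%:~R) ltr_int; lia.
Qed.

Theorem theorem2 (C : numClosedFieldType) (N : nat) (sh : seq nat) (k : C)
  (rho : {perm 'I_N} -> vmat C N sh)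
  (H : vpoly C N sh -> vpoly C N sh -> C)
  (zeta : mono N -> tab N sh -> vpoly C N sh)
  (lam : mono N) (T TR TS : tab N sh) :
  is_partition N sh -> sh != [:: N] -> sh != nseq N 1%N ->
  - ((hook sh)%:R)^-1 < k < ((hook sh)%:R)^-1 ->
  is_young_rep rho ->
  is_form k rho H ->
  (forall (a : mono N) (T0 : tab N sh), is_zeta k rho a T0 (zeta a T0)) ->
  (forall i j : 'I_N, (i <= j)%N -> (lam j <= lam i)%N) ->
  colstrict sh (fill lam T) ->
  is_numbered (TRnum sh (fill lam T)) TR ->
  is_numbered (TSnum sh (fill lam T)) TS ->
  H (Jpoly k zeta lam TS) (Jpoly k zeta lam TS) =
    (size (Tset lam TS))%:R *
      (Ceps 1 TR / (Ceps 1 TS * Eeps k 1 (minusm lam) TR)) *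
      H (zeta lam TS) (zeta lam TS).
Proof.
move=> sh_part _ _ kb rhoP HP zetaP srt cF nR nS.
have [k_real k_small] := int_lin_neq0 kb.
(* The numbering reaches every cell, so T_S covers the diagram, and counting extends this to all
   tableaux. *)
have onto U : @onto_diag N sh U.
  by apply: (@onto_diag_all _ _ TS) => c /nS[p [_ E]]; exists p.
have fS := fill_TS sh_part onto srt nS; have fR := fill_TR sh_part onto srt nR.
(* T and T_S have the same filling, so T_S replaces T in all hypotheses. *)
by rewrite -fS in cF nR nS fR; exact: (norm_formula sh_part onto rhoP k_small k_real HP zetaP srt cF nS nR fR).
Qed.
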